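(* Let $d\ge2$ and let $(X_i)$ be as in the context with $X_i\in\mathcal L^{d+1}$ and $\mathbb E X_i=0$. If $\sum_{k=0}^\infty k^{d-1}\delta_{d+1}(k)<\infty$, then $$\sum_{k_1,\ldots,k_d\in\mathbb Z}\big|\mathrm{Cum}(X_0,X_{k_1},\ldots,X_{k_d})\big|<\infty.$$
   Context: $(\epsilon_i)_{i\in\mathbb Z}$ i.i.d., $X_i=g(\ldots,\epsilon_{i-1},\epsilon_i)$ with $g$ measurable, a stationary process. $\|X\|_p=(\mathbb E|X|^p)^{1/p}$. With $(\epsilon_i')$ an independent i.i.d. copy and $X_i^*$ equal to $X_i$ with $\epsilon_0$ replaced by $\epsilon_0'$, $\delta_p(i)=\|X_i-X_i^*\|_p$ for $i\ge0$. For a random vector $(Y_1,\ldots,Y_k)$ with $\|Y_i\|_k<\infty$, the joint cumulant is $\mathrm{Cum}(Y_1,\ldots,Y_k)=\sum(-1)^{p-1}(p-1)!\prod_{j=1}^p\mathbb E\prod_{i\in\nu_j}Y_i$, the sum over all partitions $\{\nu_1,\ldots,\nu_p\}$ of $\{1,\ldots,k\}$ into nonempty blocks. *)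

(* Defs.v *)
From HB Require Import structures.
From mathcomp Require Import all_boot all_order all_algebra.
From mathcomp Require Import all_classical all_reals all_analysis.
Set Implicit Arguments. Unset Strict Implicit. Unset Printing Implicit Defensive.
Import Order.TTheory GRing.Theory Num.Theory.
Local Open Scope classical_set_scope.
Local Open Scope ring_scope.

Definition seq_cylinders {dE} (E : measurableType dE) : set (set (nat -> E)) :=
  [set C | exists n (A : set E), measurable A /\ C = (fun s => s n) @^-1` A].

Definition prod_measurable_fun {dE} (E : measurableType dE) {R : realType}
  (g : (nat -> E) -> R) : Prop :=
  forall B : set R, measurable B -> <<s @seq_cylinders _ E >> (g @^-1` B).

Definition mutually_independent {d} {T : measurableType d} {R : realType}
  (P : probability T R) {I : eqType} {dE} {E : measurableType dE}
  (Y : I -> T -> E) : Prop :=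
  forall (s : seq I) (A : I -> set E), uniq s ->
    (forall i, i \in s -> measurable (A i)) ->
    P (\big[setI/setT]_(i <- s) (Y i @^-1` A i)) =
    (\prod_(i <- s) P (Y i @^-1` A i))%E.

Local Close Scope classical_set_scope.
Definition cumulant {d} {T : measurableType d} {R : realType}
  (P : probability T R) (k : nat) (Y : 'I_k -> T -> R) : R :=
  \sum_(Q : {set {set 'I_k}} | finset.partition Q [set: 'I_k])
     ((-1) ^+ (#|Q|.-1) * (#|Q|.-1)`!%:R *
      \prod_(nu in Q) fine ('E_P[fun w => \prod_(i in nu) Y i w]))%R.

Local Open Scope classical_set_scope.
(* The process X_i = g(..., eps_{i-1}, eps_i); coordinate j of the argument
   of g is eps_{i-j}. *)
Definition bshift {d} {T : measurableType d} {R : realType} {dE}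
  {E : measurableType dE} (g : (nat -> E) -> R) (eps : int -> T -> E)
  (i : int) : T -> R :=
  fun w => g (fun j : nat => eps (i - j%:Z)%R w).

Definition bshift_star {d} {T : measurableType d} {R : realType} {dE}
  {E : measurableType dE} (g : (nat -> E) -> R) (eps eps' : int -> T -> E)
  (i : int) : T -> R :=
  fun w => g (fun j : nat =>
    if (i - j%:Z)%R == 0%R then eps' 0%R w else eps (i - j%:Z)%R w).

Definition fdm {d} {T : measurableType d} {R : realType} {dE}
  {E : measurableType dE} (P : probability T R) (g : (nat -> E) -> R)
  (eps eps' : int -> T -> E) (p : R) (i : nat) : \bar R :=
  Lnorm P p%:E (fun w => (bshift g eps i w - bshift_star g eps eps' i w)%:E).

(* Main.v *)
Require Import Defs.
From HB Require Import structures.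
From mathcomp Require Import all_boot all_order all_algebra.
From mathcomp Require Import all_classical all_reals all_analysis.
From mathcomp Require Import measurable_realfun.
From mathcomp Require Import ring zify.
Set Implicit Arguments. Unset Strict Implicit. Unset Printing Implicit Defensive.
Import Order.TTheory GRing.Theory Num.Theory.

(** Cumulants vanish on independent blocks, because the joint cumulant is the
    coefficient of N in the polynomial N |-> sum over f : I -> [N] of the product of the
    moments of the fibres of f, and this polynomial is multiplicative over independent
    blocks while each factor is divisible by N.

    Order the times t_0, ..., t_d and split them at their largest gap into A (times at
    most s) and B (times after s).  In the variables of B, replace eps_s, eps_(s-1), ...
    one after the other by independent copies.  In the limit the two blocks are
    independent and the cumulant is zero.  One step, at index c, leaves the cumulant
    unchanged if eps_c is also refreshed in A (exchangeability), so its effect is a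
    double difference: by multilinearity and the Hoelder inequality it is at most a
    constant times the sum over a in A, b in B of delta(t_a - c) delta(t_b - c).  Gaining
    a factor from both sides of the gap saves one power of k: after summing over c, the
    number of configurations with t_b - t_a = q is O(q^(d-1)), and
    sum_q q^(d-1) sum_v delta(v) delta(v + q) <=
      (sum_v delta(v)) (sum_m m^(d-1) delta(m)). *)

(** * Cumulants of independent blocks *)

Section CumulantAlgebra.
Local Open Scope ring_scope.

(** Only moments of order d + 1 exist and g is merely measurable; this shapes the proof. Originals
    and copies of the innovations form one i.i.d. family indexed by [bool * int], and every variable
    in play is [shifted rho t] for an injective relabelling [rho]: an identity in law then amounts
    to a choice of two injections. Since g reads the whole past, finitely many refreshes need not
    separate the blocks. That the error disappears in the limit is an L^k statement, which has to be
    obtained from measurability and $\|X_0\|_k<\infty$ alone, with k = d + 1. As constants do not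
    matter, norms enter only through upper bounds on k-th moments. *)

Lemma preim_partition_comp_pblock (I : finType) (T : eqType)
    (Q : {set {set I}}) (h : {set I} -> T) :
  finset.partition Q [set: I] -> (forall nu nu', nu \in Q -> nu' \in Q -> h nu = h nu' -> nu = nu') ->
  preim_partition (fun x => h (finset.pblock Q x)) [set: I] = Q.
Proof.
move=> pQ hinj; have [/eqP cQ _ _] := and3P pQ.
rewrite -[RHS](preim_partition_pblock pQ); apply: eq_in_imset => x _.
apply/setP=> y; rewrite !inE /=; apply/eqP/eqP => [hE|->//].
by apply: hinj => //; apply: finset.pblock_mem; rewrite cQ inE.
Qed.

Lemma card_preim_partition (I : finType) (n : nat) (Q : {set {set I}}) :
  finset.partition Q [set: I] ->
  #|[set f : {ffun I -> 'I_n.+1} | preim_partition f [set: I] == Q]|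
    = (n.+1 ^_ #|Q|)%N.
Proof.
move=> pQ; have [/eqP cQ tQ Q0] := and3P pQ.
have blQ x : finset.pblock Q x \in Q by apply: finset.pblock_mem; rewrite cQ inE.
pose QT : finType := {nu : {set I} | nu \in Q}.
pose bl x : QT := Sub (finset.pblock Q x) (blQ x).
pose Phi (h : {ffun QT -> 'I_n.+1}) := [ffun x => h (bl x)] : {ffun I -> 'I_n.+1}.
have pick_in (nu : QT) : exists x, x \in val nu.
  apply/set0Pn; apply: contra Q0 => /eqP <-; exact: valP.
have blE (nu : QT) x : x \in val nu -> bl x = nu.
  by move=> xnu; apply: val_inj; rewrite /= (finset.def_pblock tQ (valP nu)).
have -> : [set f : {ffun I -> 'I_n.+1} | preim_partition f [set: I] == Q] =
    Phi @: [set h : {ffun QT -> 'I_n.+1} | injectiveb h].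
  apply/setP => f; rewrite inE; apply/eqP/imsetP => [fQ|[h]].
    exists [ffun nu : QT => odflt ord0 (omap f [pick x in val nu])].
      have eqf x y : (f x == f y) = (y \in finset.pblock Q x).
        have := @pblock_equivalence_partition _ (fun x y => f x == f y) [set: I].
        rewrite -/(preim_partition f [set: I]) fQ => -> //.
        by split => // /eqP ->.
      rewrite inE; apply/injectiveP => nu nu'; rewrite !ffunE.
      case: pickP => [x xnu|]; last by have [x xnu] := pick_in nu => /(_ x); rewrite xnu.
      case: pickP => [y ynu|]; last by have [y ynu] := pick_in nu' => /(_ y); rewrite ynu.
      move=> /= /eqP; rewrite eqf => yx; rewrite -(blE _ _ xnu) -(blE _ _ ynu).
      by apply: val_inj => /=; apply/esym/finset.same_pblock.
    apply/ffunP => x; rewrite !ffunE.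
    case: pickP => [y ynu|/(_ x)] /=; last by rewrite finset.mem_pblock cQ inE.
    have := @pblock_equivalence_partition _ (fun x y => f x == f y) [set: I].
    rewrite -/(preim_partition f [set: I]) fQ => /(_ _ x y).
    by rewrite ynu !inE => /(_ _ isT isT) H; apply/eqP; rewrite -H // => ? ? ? *; split => // /eqP ->.
  rewrite inE => /injectiveP hinj ->.
  (* Extends h by [None] to all sets, so that the preceding lemma applies; only the values on Q
     matter. *)
  pose h' (nu : {set I}) : option 'I_n.+1 := omap h (insub nu).
  rewrite -[RHS](@preim_partition_comp_pblock _ _ Q h' pQ).
    apply: eq_in_imset => x _; apply/setP => y; rewrite !inE /= !ffunE /h'.
    by rewrite (@insubT _ (fun nu => nu \in Q) QT _ (blQ x)) (@insubT _ (fun nu => nu \in Q) QT _ (blQ y)).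
  move=> nu nu' nuQ nuQ'; rewrite /h' (@insubT _ (fun nu => nu \in Q) QT _ nuQ)
    (@insubT _ (fun nu => nu \in Q) QT _ nuQ') /= => -[] /hinj.
  by move/(congr1 val).
rewrite card_in_imset.
  by rewrite card_inj_ffuns card_ord card_sig.
move=> h h' _ _ /ffunP hh'; apply/ffunP => nu.
have [x /blE <-] := pick_in nu.
by have := hh' x; rewrite !ffunE.
Qed.

Definition ffactX (R : nzRingType) (q : nat) : {poly R} :=
  \prod_(i < q) ('X - (i%:R)%:P).

Lemma horner_ffactX (R : comNzRingType) (q n : nat) :
  (ffactX R q).[n%:R] = (n ^_ q)%:R.
Proof.
elim: q => [|q IH]; first by rewrite /ffactX big_ord0 hornerC ffactn0.
rewrite /ffactX big_ord_recr /= hornerM -/(ffactX R q) IH hornerXsubC ffactnSr natrM.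
have [nq|qn] := ltnP n q; first by rewrite ffact_small // !mul0r.
by rewrite natrB.
Qed.

Lemma coef0_ffactX (R : comNzRingType) (q : nat) : (0 < q)%N -> (ffactX R q)`_0 = 0.
Proof.
case: q => // q _; rewrite /ffactX big_ord_recl /= subr0.
by rewrite coefXM.
Qed.

(** The factor for i = 0 is X itself, so the linear coefficient is the product of the -i with 0 < i
    < q: the weight of a partition into q blocks in [cumulant]. *)
Lemma coef1_ffactX (R : comNzRingType) (q : nat) : (0 < q)%N ->
  (ffactX R q)`_1 = (-1) ^+ q.-1 * (q.-1)`!%:R.
Proof.
case: q => // q _; rewrite /ffactX big_ord_recl /= subr0 coefXM /=.
rewrite -horner_coef0 horner_prod.
under eq_bigr => i _ do rewrite hornerXsubC sub0r.
rewrite prodrN card_ord fact_prod natr_prod big_add1 big_mkord.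
by congr (_ * _); apply: eq_bigr => i _.
Qed.

(** If m gives the joint moments of $(Y_i)$, the value at a positive integer N is $\mathbb
    E\prod_i\sum_{r\le N}Y_i^{(r)}$ for N independent copies of the whole vector. *)
Definition cumulant_poly (R : comNzRingType) (I : finType) (m : {set I} -> R) :
  {poly R} :=
  \sum_(Q : {set {set I}} | finset.partition Q [set: I])
    (\prod_(nu in Q) m nu) *: ffactX R #|Q|.

(* A function I -> 'I_n.+1 is a set partition (its fibres) together with an injective
   labelling of the blocks, whence the falling factorials. *)
Lemma horner_cumulant_poly (R : comNzRingType) (I : finType)
    (m : {set I} -> R) (n : nat) : m finset.set0 = 1 ->
  (cumulant_poly m).[n.+1%:R] =
  \sum_(f : {ffun I -> 'I_n.+1}) \prod_(r < n.+1) m (f @^-1: [set r]).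
Proof.
move=> m0; rewrite /cumulant_poly horner_sum.
have fibers (f : {ffun I -> 'I_n.+1}) : \prod_(r < n.+1) m (f @^-1: [set r]) =
    \prod_(nu in preim_partition f [set: I]) m nu.
  have -> : preim_partition f [set: I] =
      [set f @^-1: [set r] | r in [set r | f @^-1: [set r] != finset.set0]].
    apply/setP => B; apply/imsetP/imsetP => [[x _ ->]|[r]].
      exists (f x); first by rewrite inE; apply/set0Pn; exists x; rewrite !inE.
      by apply/setP => y; rewrite !inE eq_sym.
    rewrite inE => /set0Pn[x]; rewrite !inE => /eqP fx ->.
    by exists x => //; apply/setP => y; rewrite !inE -fx eq_sym.
  rewrite big_imset /=; last first.
    move=> r r'; rewrite inE => /set0Pn[x]; rewrite !inE => /eqP fx _ /setP/(_ x).
    by rewrite !inE fx eqxx => /esym/eqP.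
  rewrite [LHS](bigID (fun r => f @^-1: [set r] != finset.set0)) /=.
  rewrite [X in _ * X]big1 ?mulr1; last by move=> r; rewrite negbK => /eqP ->.
  by apply: eq_bigl => r; rewrite inE.
under [RHS]eq_bigr => f _ do rewrite fibers.
rewrite (partition_big (fun f : {ffun I -> 'I_n.+1} => preim_partition f [set: I])
   (fun Q => finset.partition Q [set: I])) /=; last by move=> f _; exact: preim_partitionP.
apply: eq_bigr => Q pQ; rewrite hornerZ horner_ffactX -(card_preim_partition n pQ).
rewrite [RHS](eq_bigr (fun _ => \prod_(nu in Q) m nu)); last by move=> f /eqP ->.
rewrite sumr_const mulr_natr; congr (_ *+ _).
by apply: eq_card => f; rewrite !inE.
Qed.

Lemma coef1_cumulant_poly (R : comNzRingType) (I : finType) (m : {set I} -> R) :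
  (0 < #|I|)%N ->
  (cumulant_poly m)`_1 =
  \sum_(Q : {set {set I}} | finset.partition Q [set: I])
     ((-1) ^+ (#|Q|.-1) * (#|Q|.-1)`!%:R * \prod_(nu in Q) m nu).
Proof.
move=> I0; rewrite coef_sum; apply: eq_bigr => Q pQ.
rewrite coefZ coef1_ffactX; first by rewrite mulrC.
rewrite lt0n; apply: contraTneq I0 => /eqP; rewrite cards_eq0 => /eqP Q0.
have [/eqP + _ _] := and3P pQ; rewrite Q0 /finset.cover big_set0 => /setP I0.
by rewrite -ltnNge ltnS leqn0; apply/pred0P => x; have := I0 x; rewrite !inE.
Qed.

Lemma coef0_cumulant_poly (R : comNzRingType) (I : finType) (m : {set I} -> R) :
  (0 < #|I|)%N -> (cumulant_poly m)`_0 = 0.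
Proof.
move=> I0; rewrite coef_sum big1 // => Q pQ; rewrite coefZ coef0_ffactX ?mulr0 //.
rewrite lt0n; apply: contraTneq I0 => /eqP; rewrite cards_eq0 => /eqP Q0.
have [/eqP + _ _] := and3P pQ; rewrite Q0 /finset.cover big_set0 => /setP I0.
by rewrite -ltnNge ltnS leqn0; apply/pred0P => x; have := I0 x; rewrite !inE.
Qed.

(** The points 1, 2, ... are distinct in a numeric domain, so a nonzero difference would have too
    many roots. *)
Lemma poly_eq_on_nat (R : numDomainType) (p q : {poly R}) :
  (forall n : nat, p.[n.+1%:R] = q.[n.+1%:R]) -> p = q.
Proof.
move=> pq; apply/eqP; rewrite -subr_eq0; apply/eqP.
set r := p - q; pose s := [seq (i.+1%:R : R) | i <- iota 0 (size r)].
have : all (root r) s.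
  by apply/allP => _ /mapP[i _ ->]; rewrite rootE /r hornerD hornerN pq subrr.
move=> rs; apply: (roots_geq_poly_eq0 rs); last by rewrite size_map size_iota.
by rewrite map_inj_uniq ?iota_uniq // => i j /eqP; rewrite eqr_nat => /eqP [].
Qed.

Lemma cumulant_indep (R : numDomainType) (I : finType) (A : {set I})
    (a b m : {set I} -> R) :
  a finset.set0 = 1 -> b finset.set0 = 1 ->
  (forall nu, m nu = a (nu :&: A)%SET * b (nu :\: A)%SET) ->
  A != finset.set0 -> A != [set: I] ->
  \sum_(Q : {set {set I}} | finset.partition Q [set: I])
     ((-1) ^+ (#|Q|.-1) * (#|Q|.-1)`!%:R * \prod_(nu in Q) m nu) = 0.
Proof.
move=> a0 b0 mE A0 AT.
have [x0 x0A] := set0Pn _ A0.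
have [y0 y0A] : exists y, y \notin A.
  by move: AT; rewrite finset.eqEsubset finset.subsetT /= => /fintype.subsetPn[y _ yA]; exists y.
rewrite -coef1_cumulant_poly; last by apply/card_gt0P; exists x0.
pose IA : finType := {x : I | x \in A}.
pose IB : finType := {x : I | x \notin A}.
pose a' (S : {set IA}) := a (val @: S); pose b' (S : {set IB}) := b (val @: S).
have -> : cumulant_poly m = cumulant_poly a' * cumulant_poly b'.
  apply: poly_eq_on_nat => n; rewrite hornerM.
  rewrite !horner_cumulant_poly ?mE ?/a' ?/b' ?imset0 ?finset.set0I ?finset.set0D ?a0 ?b0 ?mulr1 //.
  (* Labellings of I are pairs of labellings, one of A and one of its complement; the default [ord0]
     is never reached. *)
  pose psi (p : {ffun IA -> 'I_n.+1} * {ffun IB -> 'I_n.+1}) : {ffun I -> 'I_n.+1} :=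
    [ffun x => if insub x is Some u then p.1 u else
               if insub x is Some v then p.2 v else ord0].
  pose phi (h : {ffun I -> 'I_n.+1}) : {ffun IA -> 'I_n.+1} * {ffun IB -> 'I_n.+1} :=
    ([ffun u => h (val u)], [ffun v => h (val v)]).
  have psiK : cancel phi psi.
    move=> h; apply/ffunP => x; rewrite ffunE; case: insubP => [u _ <-|xA].
      by rewrite ffunE.
    by rewrite insubT ffunE.
  have psiA p (u : IA) : psi p (val u) = p.1 u by rewrite ffunE valK.
  have psiB p (v : IB) : psi p (val v) = p.2 v.
    by rewrite ffunE insubN ?(valP v) // valK.
  have phiK : cancel psi phi.
    by move=> [f g]; congr pair; apply/ffunP => u; rewrite ffunE ?psiA ?psiB.
  rewrite (reindex psi) /=; last by exists phi => ? _; [exact: phiK|exact: psiK].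
  rewrite big_distrl /=; under [RHS]eq_bigr => f _ do rewrite big_distrr /=.
  rewrite pair_big /=; apply: eq_bigr => -[f g] _ /=; rewrite -big_split /=.
  apply: eq_bigr => r _; rewrite mE; congr (a _ * b _).
    apply/setP => x; rewrite !inE; apply/andP/imsetP => [[/eqP fr xA]|[u]].
      by exists (Sub x xA) => //; rewrite !inE -fr -(psiA (f, g)).
    by rewrite !inE => /eqP <- ->; rewrite -(psiA (f, g)) eqxx; split => //; exact: (valP u).
  apply/setP => x; rewrite !inE; apply/andP/imsetP => [[xA /eqP fr]|[u]].
    by exists (Sub x xA) => //; rewrite !inE -fr -(psiB (f, g)).
  by rewrite !inE => /eqP <- ->; rewrite -(psiB (f, g)) eqxx; split => //; exact: (valP u).
rewrite coefM !big_ord_recl big_ord0 /= !coef0_cumulant_poly ?mul0r ?mulr0 ?addr0 //.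
- by apply/card_gt0P; exists (Sub y0 y0A).
- by apply/card_gt0P; exists (Sub x0 x0A).
Qed.

End CumulantAlgebra.

(** * Laws of independent identically distributed families *)

Section ProductLaw.
Local Open Scope classical_set_scope.
Local Open Scope ring_scope.

Definition cylinders (I : Type) {dE} (E : measurableType dE) : set (set (I -> E)) :=
  [set C | exists i (A : set E), measurable A /\ C = (fun s => s i) @^-1` A].

(** The product sigma-algebra for any index type, so that reindexings are measurable maps between
    such spaces; for [nat] it is by definition the one in [prod_measurable_fun]. *)
Definition prodType (I : Type) {dE} (E : measurableType dE) :=
  g_sigma_algebraType (@cylinders I _ E).

Definition prod_measurable {I : Type} {dE} {E : measurableType dE}
    {d} {U : sigmaRingType d} (F : (I -> E) -> U) :=
  @measurable_fun _ _ (prodType I E) U setT F.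

Lemma measurable_prodType (I : Type) {dE} (E : measurableType dE)
    {d} (T : measurableType d) (xi : I -> T -> E) :
  (forall i, measurable_fun setT (xi i)) ->
  measurable_fun setT ((fun w i => xi i w) : T -> prodType I E).
Proof.
move=> mxi; apply: (@measurability _ _ T (prodType I E) setT _ (@cylinders I _ E) erefl).
by move=> _ [_ [i [A [mA ->]]] <-]; exact: mxi.
Qed.

Lemma measurable_coord (I : Type) {dE} (E : measurableType dE) (i : I) :
  measurable_fun setT ((fun s => s i) : prodType I E -> E).
Proof.
move=> _ A mA; rewrite setTI; apply: sub_sigma_algebra.
by exists i, A.
Qed.

Lemma measurable_reindex (I J : Type) {dE} (E : measurableType dE) (u : J -> I) :
  measurable_fun setT ((fun s j => s (u j)) : prodType I E -> prodType J E).
Proof. by apply: measurable_prodType => j; exact: measurable_coord. Qed.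

(** Cylinders over one coordinate are not stable under intersection; finite-dimensional boxes are,
    and a probability measure is determined by its values on them. *)
Definition boxes (I : eqType) {dE} (E : measurableType dE) : set (set (I -> E)) :=
  [set C | exists (s : seq I) (A : I -> set E),
    (forall i, measurable (A i)) /\ C = [set y | forall i, i \in s -> A i (y i)]].

Lemma boxes_setI (I : eqType) {dE} (E : measurableType dE) :
  setI_closed (@boxes I _ E).
Proof.
move=> _ _ [s [A [mA ->]]] [s' [A' [mA' ->]]].
exists (s ++ s'), (fun i => (if i \in s then A i else setT) `&`
                            (if i \in s' then A' i else setT)).
split=> [i|]; first by apply: measurableI; case: ifP.
apply/seteqP; split => y /=.
  by move=> [yA yA'] i _; split; case: ifPn => // ?; [exact: yA|exact: yA'].
move=> H; split=> i si; have := H i; rewrite mem_cat si ?orbT => /(_ isT)[];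
  by rewrite ?si // => ?; rewrite ?si.
Qed.

Lemma measurable_box (I : eqType) {dE} (E : measurableType dE) B :
  @boxes I _ E B -> measurable (B : set (prodType I E)).
Proof.
move=> [s [A [mA ->]]].
have -> : [set y | forall i, i \in s -> A i (y i)] =
    \big[setI/setT]_(i <- s) ((fun y : prodType I E => y i) @^-1` A i).
  apply/seteqP; split => y /=.
    elim: s => [|i s IH] H; first by rewrite big_nil.
    rewrite big_cons; split; first by apply: H; rewrite mem_head.
    by apply: IH => j js; apply: H; rewrite in_cons js orbT.
  elim: s => [|i s IH] //; rewrite big_cons => -[Ai /IH {}IH] j.
  by rewrite in_cons => /predU1P[->//|]; exact: IH.
apply: bigsetI_measurable => i _; rewrite -[X in measurable X]setTI.
exact: measurable_coord.
Qed.

Lemma boxesE (I : eqType) {dE} (E : measurableType dE) :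
  @measurable _ (prodType I E) = <<s @boxes I _ E >>.
Proof.
apply/seteqP; split; apply: smallest_sub; try exact: smallest_sigma_algebra.
- move=> _ [i [A [mA ->]]]; apply: sub_sigma_algebra.
  exists [:: i], (fun=> A); split => //; apply/seteqP; split => y /=.
    by move=> Ay j; rewrite inE => /eqP ->.
  by apply; rewrite mem_head.
- by move=> B; exact: measurable_box.
Qed.

(** * Equality in law of two independent families with the same marginals *)

Section TwoFamilies.
Context {dE} {E : measurableType dE} {R : realType} {I : choiceType}.
Context {d1} {T1 : measurableType d1} (P1 : probability T1 R) (xi1 : I -> T1 -> E).
Context {d2} {T2 : measurableType d2} (P2 : probability T2 R) (xi2 : I -> T2 -> E).
Hypothesis mxi1 : forall i, measurable_fun setT (xi1 i).
Hypothesis mxi2 : forall i, measurable_fun setT (xi2 i).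
Hypothesis ind1 : mutually_independent P1 xi1.
Hypothesis ind2 : mutually_independent P2 xi2.
Hypothesis eqmarg : forall i A, measurable A -> P1 (xi1 i @^-1` A) = P2 (xi2 i @^-1` A).

Lemma indep_box {d} {T : measurableType d} (P : probability T R) (xi : I -> T -> E)
    (s : seq I) (A : I -> set E) :
  mutually_independent P xi -> (forall i, measurable (A i)) ->
  P ((fun w i => xi i w) @^-1` [set y | forall i, i \in s -> A i (y i)]) =
  (\prod_(i <- undup s) P (xi i @^-1` A i))%E.
Proof.
move=> ind mA; rewrite -ind ?undup_uniq //; congr (P _).
rewrite -bigcap_seq; apply/seteqP; split => w /= H i.
  by rewrite /= mem_undup; exact: H.
by move=> si; apply: (H i); rewrite /= mem_undup.
Qed.

Lemma law_unique (B : set (prodType I E)) : measurable B ->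
  P1 ((fun w i => xi1 i w) @^-1` B) = P2 ((fun w i => xi2 i w) @^-1` B).
Proof.
pose X1 : {mfun T1 >-> prodType I E} :=
  MeasurableFun.Pack (MeasurableFun.Class (isMeasurableFun.Build _ _ _ _ _ (measurable_prodType mxi1))).
pose X2 : {mfun T2 >-> prodType I E} :=
  MeasurableFun.Pack (MeasurableFun.Class (isMeasurableFun.Build _ _ _ _ _ (measurable_prodType mxi2))).
move=> mB.
apply: (@measure_unique _ R (prodType I E) (@boxes I _ E) (fun=> setT) _ _ _ _
  (distribution P1 X1) (distribution P2 X2)) => //.
- exact: boxesE.
- exact: boxes_setI.
- by move=> _; exists [::], (fun=> setT); split => //; apply/seteqP; split.
- by apply/seteqP; split => // y _; exists 0%N.
- move=> _ [s [A [mA ->]]].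
  apply: etrans (indep_box s ind1 mA) _.
  apply: etrans _ (esym (indep_box s ind2 mA)).
  by apply: eq_bigr => i _; exact: eqmarg.
- by move=> _; rewrite /= /distribution /pushforward preimage_setT probability_setT ltry.
Qed.

Lemma law_ge0_integral (F : (I -> E) -> \bar R) :
  prod_measurable F -> (forall y, 0 <= F y)%E ->
  (\int[P1]_w F (fun i => xi1 i w) = \int[P2]_w F (fun i => xi2 i w))%E.
Proof.
move=> mF F0.
have F0' : {in setT, forall y : prodType I E, 0 <= F y}%E by move=> ? _; exact: F0.
have := ge0_integral_pushforward (measurable_prodType mxi1) P1 measurableT mF F0'.
rewrite preimage_setT /= => <-.
have := ge0_integral_pushforward (measurable_prodType mxi2) P2 measurableT mF F0'.
rewrite preimage_setT /= => <-.
apply: eq_measure_integral; [exact: measurable_prodType|exact: measurable_prodType|].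
by move=> ? ? B mB _; exact: law_unique.
Qed.

Lemma law_integral (F : (I -> E) -> \bar R) :
  prod_measurable F ->
  (\int[P1]_w F (fun i => xi1 i w) = \int[P2]_w F (fun i => xi2 i w))%E.
Proof.
move=> mF; rewrite integralE [RHS]integralE.
congr (_ - _)%E.
- transitivity (\int[P1]_w F^\+ (fun i => xi1 i w))%E.
    by apply: eq_integral => w _; rewrite !funeposE.
  rewrite (law_ge0_integral (measurable_funepos mF) (funepos_ge0 _)).
  by apply: eq_integral => w _; rewrite !funeposE.
- transitivity (\int[P1]_w F^\- (fun i => xi1 i w))%E.
    by apply: eq_integral => w _; rewrite !funenegE.
  rewrite (law_ge0_integral (measurable_funeneg mF) (funeneg_ge0 _)).
  by apply: eq_integral => w _; rewrite !funenegE.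
Qed.

End TwoFamilies.

(** * Relabelling and resampling one i.i.d. family *)

Section IID.
Context {dE} {E : measurableType dE} {R : realType} {J : choiceType}.
Context {d} {T : measurableType d} (P : probability T R) (xi : J -> T -> E).
Hypothesis mxi : forall i, measurable_fun setT (xi i).
Hypothesis ind : mutually_independent P xi.
Hypothesis eqmarg : forall i j A, measurable A -> P (xi i @^-1` A) = P (xi j @^-1` A).

Lemma indep_subfamily (I : choiceType) (u : I -> J) : injective u ->
  mutually_independent P (fun i => xi (u i)).
Proof.
move=> uI s A us mA.
(* Transports the events along [u]; labels outside its image get the sure event. *)
pose A' j := if [pick i : seq_sub s | u (val i) == j] is Some i then A (val i) else setT.
have A'u i : i \in s -> A' (u i) = A i.
  move=> si; rewrite /A'; case: pickP => [k /eqP /uI -> //|/(_ (SeqSub si))].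
  by rewrite eqxx.
have := @ind (map u s) A'; rewrite map_inj_uniq // => /(_ us).
rewrite !big_map => H.
have : forall j, j \in map u s -> measurable (A' j).
  by move=> _ /mapP[i si ->]; rewrite A'u //; exact: mA.
move=> /H {}H; rewrite big_seq [RHS]big_seq.
rewrite big_seq [in RHS]big_seq in H.
under eq_bigr => i si do rewrite -(A'u i si).
by rewrite H; apply: eq_bigr => i si; rewrite A'u.
Qed.

(** The source of the identities in law between relabelled processes: two injections read two i.i.d.
    families with the same marginals. *)
Lemma iid_law (I : choiceType) (u v : I -> J) (F : (I -> E) -> \bar R) :
  injective u -> injective v ->
  prod_measurable F ->
  (\int[P]_w F (fun i => xi (u i) w) = \int[P]_w F (fun i => xi (v i) w))%E.
Proof.
move=> uI vI mF; apply: (@law_integral _ _ _ _ _ _ P (fun i => xi (u i))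
  _ _ P (fun i => xi (v i))) => //.
- exact: indep_subfamily.
- exact: indep_subfamily.
- by move=> i A; exact: eqmarg.
Qed.

(** Coordinates in [chi] are read from the first factor and the others from the second, so an event
    given by finitely many coordinates is a rectangle in the product space. *)
Lemma indep_resample (chi : pred J) :
  mutually_independent (P \x P)%E
    (fun j (w : T * T) => if chi j then xi j w.1 else xi j w.2).
Proof.
move=> s A us mA.
have -> : \big[setI/setT]_(i <- s)
    ((fun w : T * T => if chi i then xi i w.1 else xi i w.2) @^-1` A i) =
  (\big[setI/setT]_(i <- [seq i <- s | chi i]) (xi i @^-1` A i)) `*`
  (\big[setI/setT]_(i <- [seq i <- s | ~~ chi i]) (xi i @^-1` A i)).
  elim: s {us mA} => [|i s IH] /=; first by rewrite !big_nil setXTT.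
  rewrite big_cons IH; case: ifP => ci /=; rewrite big_cons.
    by apply/seteqP; split => -[w1 w2] /=; tauto.
  by apply/seteqP; split => -[w1 w2] /=; tauto.
have mX i : i \in s -> measurable (xi i @^-1` A i).
  by move=> si; rewrite -[X in measurable X]setTI; apply: mxi => //; exact: mA.
have mbig (p : pred J) :
    measurable (\big[setI/setT]_(i <- [seq i <- s | p i]) (xi i @^-1` A i)).
  rewrite big_seq; apply: bigsetI_measurable => i.
  by rewrite mem_filter => /andP[_ /mX].
transitivity (P (\big[setI/setT]_(i <- [seq i <- s | chi i]) (xi i @^-1` A i)) *
  P (\big[setI/setT]_(i <- [seq i <- s | ~~ chi i]) (xi i @^-1` A i)))%E.
  exact: product_measure1E.
rewrite !ind ?filter_uniq //; last 2 first.
- by move=> i; rewrite mem_filter => /andP[_ /mA].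
- by move=> i; rewrite mem_filter => /andP[_ /mA].
rewrite !big_filter [RHS](bigID chi) /=; congr (_ * _)%E.
- rewrite big_seq_cond [RHS]big_seq_cond; apply: eq_bigr => i /andP[si ci].
  have -> : (fun w : T * T => if chi i then xi i w.1 else xi i w.2) @^-1` A i =
     (xi i @^-1` A i) `*` setT by apply/seteqP; split => -[w1 w2] /=; rewrite ci; tauto.
  transitivity (P (xi i @^-1` A i) * P setT)%E;
    last by apply: esym; apply: product_measure1E => //; exact: mX.
  by rewrite probability_setT mule1.
- rewrite big_seq_cond [RHS]big_seq_cond; apply: eq_bigr => i /andP[si ci].
  have -> : (fun w : T * T => if chi i then xi i w.1 else xi i w.2) @^-1` A i =
     setT `*` (xi i @^-1` A i)
    by apply/seteqP; split => -[w1 w2] /=; rewrite (negbTE ci); tauto.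
  transitivity (P setT * P (xi i @^-1` A i))%E;
    last by apply: esym; apply: product_measure1E => //; exact: mX.
  by rewrite probability_setT mul1e.
Qed.

Lemma iid_law_resample (chi : pred J) (F : (J -> E) -> \bar R) :
  prod_measurable F ->
  (\int[P]_w F (fun j => xi j w) =
   \int[P \x P]_w F (fun j => if chi j then xi j w.1 else xi j w.2))%E.
Proof.
move=> mF; apply: (@law_integral _ _ _ _ _ _ P xi _ _ (P \x P)%E
   (fun j (w : T * T) => if chi j then xi j w.1 else xi j w.2)) => //.
- move=> j; case: (chi j); apply: measurableT_comp => //.
- exact: indep_resample.
- move=> j A mA.
  have mX : measurable (xi j @^-1` A).
    by rewrite -[X in measurable X]setTI; exact: mxi.
  case cj : (chi j).
  + transitivity ((P \x P)%E ((xi j @^-1` A) `*` setT)).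
      transitivity (P (xi j @^-1` A) * P setT)%E;
        last by apply: esym; exact: product_measure1E.
      by rewrite probability_setT mule1.
    by congr (_ _); apply/seteqP; split => -[w1 w2] /=; tauto.
  + transitivity ((P \x P)%E (setT `*` (xi j @^-1` A))).
      transitivity (P setT * P (xi j @^-1` A))%E;
        last by apply: esym; exact: product_measure1E.
      by rewrite probability_setT mul1e.
    by congr (_ _); apply/seteqP; split => -[w1 w2] /=; tauto.
Qed.

(* Resample the coordinates outside [chi] on a second copy of the space;
   the law is unchanged, and Fubini separates the two factors. *)
Lemma iid_expectationM (chi : pred J) (F G : (J -> E) -> R) :
  prod_measurable F ->
  prod_measurable G ->
  (forall y y', {in chi, y =1 y'} -> F y = F y') ->
  (forall y y', {in predC chi, y =1 y'} -> G y = G y') ->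
  P.-integrable setT (fun w => (F (fun j => xi j w))%:E) ->
  P.-integrable setT (fun w => (G (fun j => xi j w))%:E) ->
  (\int[P]_w (F (fun j => xi j w) * G (fun j => xi j w))%:E =
   (\int[P]_w (F (fun j => xi j w))%:E) * (\int[P]_w (G (fun j => xi j w))%:E))%E.
Proof.
move=> mF mG Fchi Gchi iF iG.
have mxi' := measurable_prodType mxi.
rewrite (@iid_law_resample chi (fun y => (F y * G y)%:E)); last first.
  by apply/measurable_EFinP; exact: measurable_funM.
pose F' w := F (fun j => xi j w); pose G' w := G (fun j => xi j w).
have mF' : measurable_fun setT F' by exact: (measurableT_comp mF mxi').
have mG' : measurable_fun setT G' by exact: (measurableT_comp mG mxi').
have FGE w : F (fun j => if chi j then xi j w.1 else xi j w.2) *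
     G (fun j => if chi j then xi j w.1 else xi j w.2) = F' w.1 * G' w.2.
  congr (_ * _); first by apply: Fchi => j; rewrite unfold_in => ->.
  by apply: Gchi => j; rewrite unfold_in /= => /negbTE ->.
under eq_integral => w _ do rewrite FGE.
have mFG : measurable_fun setT (fun w : T * T => (F' w.1 * G' w.2)%:E).
  apply/measurable_EFinP; apply: measurable_funM.
    exact: (measurableT_comp mF' measurable_fst).
  exact: (measurableT_comp mG' measurable_snd).
have eF : (\int[P]_w (F' w)%:E)%E \is a fin_num by exact: integrable_fin_num.
have eG : (\int[P]_w (G' w)%:E)%E \is a fin_num by exact: integrable_fin_num.
rewrite -integral12_prod_meas1 /fubini_F /=; last first.
  apply/integrable12ltyP => //=.
  under eq_integral => x _.
    under eq_integral => y _ do rewrite normrM EFinM.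
    rewrite ge0_integralZl //; last first.
      by apply/measurable_EFinP; exact: measurableT_comp.
    over.
  rewrite /= ge0_integralZr //; last 2 first.
  - by apply/measurable_EFinP; exact: measurableT_comp.
  - by apply: integral_ge0.
  have [_ fF] := integrableP _ _ _ iF; have [_ fG] := integrableP _ _ _ iG.
  by rewrite lte_mul_pinfty //; [exact: integral_ge0|rewrite ge0_fin_numE//; exact: integral_ge0].
under eq_integral => x _.
  under eq_integral => y _ do rewrite EFinM.
  rewrite integralZl //.
  over.
rewrite /=.
by rewrite -/(F' _) -(fineK eG) integralZr.
Qed.

End IID.
End ProductLaw.

(** * Moment and cumulant bounds *)

Section Moments.
Local Open Scope ring_scope.
Local Open Scope classical_set_scope.
Context {dT} {T : measurableType dT} {R : realType} (P : probability T R).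

(** The largest factor decides: its power |S| is at most 1 if it is at most 1, and otherwise at most
    its k-th power. *)
Lemma prod_le_sum_expr (I : finType) (S : {set I}) (k : nat) (y : I -> R) :
  (#|S| <= k)%N -> (forall i, 0 <= y i) ->
  \prod_(i in S) y i <= 1 + \sum_(i in S) y i ^+ k.
Proof.
move=> Sk y0; have [->|[x0 x0S]] := set_0Vmem S.
  by rewrite !big_set0 addr0.
pose m := [arg max_(i > x0 in S) y i]%O.
have [mS mmax] : m \in S /\ forall i, i \in S -> y i <= y m.
  by rewrite /m; case: arg_maxP => // i iS imax; split.
have ym : \prod_(i in S) y i <= y m ^+ #|S|.
  rewrite -prodr_const; apply: ler_prod => i iS.
  by rewrite y0 mmax.
apply: (le_trans ym); have [y1|y1] := leP (y m) 1.
  apply: (@le_trans _ _ 1); first by apply: exprn_ile1.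
  by rewrite lerDl sumr_ge0 // => i _; exact: exprn_ge0.
rewrite (bigD1 m) //= addrCA.
apply: (@le_trans _ _ (y m ^+ k)); first by rewrite ler_eXn2l.
rewrite lerDl addr_ge0 // sumr_ge0 // => i _; exact: exprn_ge0.
Qed.

Definition kbounded (k : nat) (Y : T -> R) (n : R) : Prop :=
  [/\ measurable_fun setT Y, 0 <= n &
      (\int[P]_w (`|Y w| ^+ k)%:E <= (n ^+ k)%:E)%E].

Lemma kbounded_zero (k : nat) (f : T -> R) : (0 < k)%N -> measurable_fun setT f ->
  kbounded k (fun w => f w - f w) 0.
Proof.
move=> k0 mf; split=> //; first exact: measurable_funB.
rewrite expr0n gtn_eqF //= (eq_integral (cst 0%E)) ?integral0 //.
by move=> w _; rewrite subrr normr0 expr0n gtn_eqF.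
Qed.

Lemma measurable_prod_in (I : finType) (S : {set I}) (Y : I -> T -> R) :
  (forall i, i \in S -> measurable_fun setT (Y i)) ->
  measurable_fun setT (fun w => \prod_(i in S) Y i w).
Proof.
move=> mY; have -> : (fun w => \prod_(i in S) Y i w) =
    (fun w => \prod_(i <- enum S) Y i w).
  by apply/funext => w; rewrite big_enum.
have {}mY : forall i, i \in enum S -> measurable_fun setT (Y i).
  by move=> i; rewrite mem_enum; exact: mY.
elim: (enum S) mY => [|i s IH] mY.
  by under eq_fun do rewrite big_nil; exact: measurable_cst.
under eq_fun do rewrite big_cons.
apply: measurable_funM; first by apply: mY; rewrite mem_head.
by apply: IH => j js; apply: mY; rewrite in_cons js orbT.
Qed.

Lemma measurable_normXr (k : nat) (Y : T -> R) : measurable_fun setT Y ->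
  measurable_fun setT (fun w => `|Y w| ^+ k).
Proof.
by move=> mY; apply: (@measurable_funX _ _ _ _ (fun w => `|Y w|)); exact: measurableT_comp.
Qed.

Lemma measurable_normX (k : nat) (Y : T -> R) : measurable_fun setT Y ->
  measurable_fun setT (fun w => (`|Y w| ^+ k)%:E).
Proof. by move=> mY; apply/measurable_EFinP; exact: measurable_normXr. Qed.

(* A crude Hoelder inequality: normalise every Y_i, then bound the product by prod_le_sum_expr. *)
Lemma moment_abs_le (I : finType) (S : {set I}) (k : nat) (Y : I -> T -> R)
    (n : I -> R) : (#|S| <= k)%N ->
  (forall i, i \in S -> kbounded k (Y i) (n i)) ->
  (\int[P]_w (`|\prod_(i in S) Y i w|)%:E <= (k.+1%:R * \prod_(i in S) n i)%:E)%E.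
Proof.
move=> Sk kY.
have mY i : i \in S -> measurable_fun setT (Y i) by move=> /kY[].
have n0 i : i \in S -> 0 <= n i by move=> /kY[].
(* If some [n i] is 0, normalisation is impossible, but then [Y i] and the whole product vanish
   almost everywhere. *)
have [/'exists_andP[i [iS /eqP ni0]]|/existsPn npos] :=
    boolP [exists i, (i \in S) && (n i == 0)].
  have k0 : (0 < k)%N by apply: leq_trans Sk; apply/card_gt0P; exists i.
  have [_ _] := kY i iS; rewrite ni0 expr0n gtn_eqF //= => Yi0.
  have Yae : {ae P, forall w, setT w -> (`|Y i w| ^+ k)%:E = 0%E}.
    apply/(ae_eq_integral_abs P measurableT (measurable_normX k (mY _ iS))).
    apply/eqP; rewrite eq_le integral_ge0 ?andbT //.
    apply: le_trans Yi0; apply: ge0_le_integral => //.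
    - by apply: measurableT_comp => //; exact: (measurable_normX k (mY _ iS)).
    - exact: (measurable_normX k (mY _ iS)).
    - by move=> w _; rewrite lee_fin ger0_norm // exprn_ge0.
  rewrite (ae_eq_integral (cst 0%E)) //.
  - by rewrite integral0 (bigD1 i) //= ni0 mul0r mulr0.
  - apply/measurable_EFinP; apply: measurableT_comp => //.
    exact: measurable_prod_in.
  - apply: filterS Yae => w /(_ Logic.I) [/eqP]; rewrite expf_eq0 k0 /= normr_eq0 => /eqP Yw _.
    by rewrite (bigD1 i) //= Yw mul0r normr0.
have {npos}n0 i : i \in S -> 0 < n i.
  by move=> iS; rewrite lt_def n0 // andbT; have := npos i; rewrite iS.
have pn0 : 0 < \prod_(i in S) n i by apply: prodr_gt0.
(* The k-th power of the normalised variable, with integral at most 1. At most k of these and the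
   term 1 give the constant k + 1. *)
pose f i w := if i \in S then n i ^- k * `|Y i w| ^+ k else 0.
have f0 i w : (0 <= (f i w)%:E)%E.
  rewrite lee_fin /f; case: ifP => // iS.
  by rewrite mulr_ge0 ?invr_ge0 ?exprn_ge0 // ltW // n0.
have mf i : measurable_fun setT (fun w => (f i w)%:E).
  apply/measurable_EFinP; rewrite /f; case iS: (i \in S) => //.
  by apply: measurable_funM => //; exact: (measurable_normXr k (mY _ iS)).
pose F w := (\sum_(i <- enum S) (f i w)%:E)%E.
have mF : measurable_fun setT F by exact: emeasurable_sum.
have F0 w : (0 <= F w)%E by exact: sume_ge0.
have step1 w : ((`|\prod_(i in S) Y i w|)%:E <= (\prod_(i in S) n i)%:E * (1%:E + F w))%E.
  rewrite /F big_enum /= sumEFin -EFinD -EFinM lee_fin.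
  rewrite normr_prod -ler_pdivrMl // -prodfV -big_split /=.
  pose y i := if i \in S then (n i)^-1 * `|Y i w| else 0.
  have y0 i : 0 <= y i.
    by rewrite /y; case: ifP => // iS; rewrite mulr_ge0 ?invr_ge0 // ltW // n0.
  have -> : \prod_(i in S) ((n i)^-1 * `|Y i w|) = \prod_(i in S) y i.
    by apply: eq_bigr => i iS; rewrite /y iS.
  apply: le_trans (prod_le_sum_expr Sk y0) _; rewrite lerD2l le_eqVlt; apply/orP; left.
  by apply/eqP/eq_bigr => i iS; rewrite /y /f iS exprMn exprVn.
have m1F : measurable_fun setT (fun w => 1%:E + F w)%E.
  by apply: emeasurable_funD => //; exact: measurable_cst.
have c1F w : (0 <= 1%:E + F w)%E by rewrite adde_ge0.
apply: (@le_trans _ _ (\int[P]_w ((\prod_(i in S) n i)%:E * (1%:E + F w))%E)%E).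
  apply: ge0_le_integral => //.
  - apply/measurable_EFinP; apply: measurableT_comp => //.
    exact: measurable_prod_in.
  - exact: measurable_funeM.
rewrite ge0_integralZl //; last by rewrite lee_fin ltW.
rewrite ge0_integralD //.
rewrite integral_cst // [X in (1%:E * X)%E]probability_setT mule1 ge0_integral_sum //.
rewrite [(k.+1%:R * _)%R]mulrC EFinM lee_pmul2l ?lte_fin //.
rewrite big_enum /= -nat1r EFinD leeD2l //.
apply: (@le_trans _ _ (\sum_(i in S) 1%:E)%E); last first.
  by rewrite sumEFin lee_fin sumr_const ler_nat.
apply: lee_sum => i iS; rewrite /f iS.
have [_ _ iY] := kY i iS.
have ni0 : (0 <= (n i ^- k)%:E)%E.
  by rewrite lee_fin invr_ge0 exprn_ge0 // ltW // n0.
under eq_integral do rewrite EFinM.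
rewrite ge0_integralZl //; last by exact: (measurable_normX k (mY _ iS)).
apply: (@le_trans _ _ ((n i ^- k)%:E * (n i ^+ k)%:E)%E).
  exact: lee_wpmul2l.
by rewrite -EFinM mulVf // expf_neq0 // gt_eqF // n0.
Qed.

Lemma moment_integrable (I : finType) (S : {set I}) (k : nat) (Y : I -> T -> R)
    (n : I -> R) : (#|S| <= k)%N ->
  (forall i, i \in S -> kbounded k (Y i) (n i)) ->
  P.-integrable setT (fun w => (\prod_(i in S) Y i w)%:E).
Proof.
move=> Sk kY; apply/integrableP; split.
  by apply/measurable_EFinP/measurable_prod_in => i /kY[].
exact: le_lt_trans (moment_abs_le Sk kY) (ltry _).
Qed.

Definition moment (I : finType) (Y : I -> T -> R) (S : {set I}) : R :=
  fine (\int[P]_w (\prod_(i in S) Y i w)%:E)%E.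

Lemma moment_le (I : finType) (S : {set I}) (k : nat) (Y : I -> T -> R)
    (n : I -> R) : (#|S| <= k)%N ->
  (forall i, i \in S -> kbounded k (Y i) (n i)) ->
  `|moment Y S| <= k.+1%:R * \prod_(i in S) n i.
Proof.
move=> Sk kY; have iY := moment_integrable Sk kY.
rewrite -lee_fin -abse_EFin fineK; last exact: integrable_fin_num.
apply: le_trans (moment_abs_le Sk kY).
by apply: le_abse_integral => //; exact: measurable_int iY.
Qed.

Lemma moment0 (I : finType) (Y : I -> T -> R) : moment Y finset.set0 = 1.
Proof.
rewrite /moment; under eq_integral do rewrite big_set0.
by rewrite integral_cst // [X in (_ * X)%E]probability_setT mule1.
Qed.

(** * Multilinearity and size of the cumulant *)

Lemma cumulantE (k : nat) (Y : 'I_k -> T -> R) :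
  cumulant P Y = \sum_(Q : {set {set 'I_k}} | finset.partition Q [set: 'I_k])
     ((-1) ^+ (#|Q|.-1) * (#|Q|.-1)`!%:R * \prod_(nu in Q) moment Y nu).
Proof.
apply: eq_bigr => Q _; congr (_ * _); apply: eq_bigr => nu _.
by rewrite unlock.
Qed.

(** Each partition has exactly one block containing j. Only the moment of that block changes, and it
    is additive in slot j because products of at most k factors are integrable. *)
Lemma cumulantB (k : nat) (F G H : 'I_k -> T -> R) (nF nG : 'I_k -> R) (j : 'I_k) :
  (forall i, kbounded k (F i) (nF i)) -> (forall i, kbounded k (G i) (nG i)) ->
  (forall i, i != j -> F i = H i /\ G i = H i) ->
  (forall w, H j w = F j w - G j w) ->
  cumulant P H = cumulant P F - cumulant P G.
Proof.
move=> kF kG eqH Hj; rewrite !cumulantE -sumrB; apply: eq_bigr => Q pQ.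
rewrite -mulrBr; congr (_ * _).
have [/eqP cQ tQ _] := and3P pQ.
have jQ : finset.pblock Q j \in Q by rewrite finset.pblock_mem // cQ inE.
have off nu : nu \in Q -> nu != finset.pblock Q j -> j \notin nu.
  by move=> nuQ; apply: contraNN => jnu; rewrite (finset.def_pblock tQ nuQ jnu).
have spl (F' : 'I_k -> T -> R) : \prod_(nu in Q) moment F' nu =
    moment F' (finset.pblock Q j) *
    \prod_(nu in Q | nu != finset.pblock Q j) moment F' nu.
  by rewrite (bigD1 (finset.pblock Q j)).
rewrite !spl.
have eqm (F' : 'I_k -> T -> R) : (forall i, i != j -> F' i = H i) ->
    \prod_(nu in Q | nu != finset.pblock Q j) moment F' nu =
    \prod_(nu in Q | nu != finset.pblock Q j) moment H nu.
  move=> F'H; apply: eq_bigr => nu /andP[nuQ /(off _ nuQ) jnu].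
  congr fine; apply: eq_integral => w _; congr (_%:E); apply: eq_bigr => i inu.
  by rewrite F'H //; apply: contraNneq jnu => <-.
rewrite (eqm F) ?(eqm G) -?mulrBl; try by move=> i /eqH[].
congr (_ * _); rewrite /moment.
have card_le (S : {set 'I_k}) : (#|S| <= k)%N by rewrite -[leqRHS]card_ord max_card.
have iF := moment_integrable (card_le (finset.pblock Q j)) (fun i _ => kF i).
have iG := moment_integrable (card_le (finset.pblock Q j)) (fun i _ => kG i).
rewrite -fineB; try exact: integrable_fin_num.
rewrite -integralB //; congr fine; apply: eq_integral => w _.
rewrite -EFinB; congr (_%:E).
have splw (F' : 'I_k -> T -> R) : \prod_(i in finset.pblock Q j) F' i w =
    F' j w * \prod_(i in finset.pblock Q j | i != j) F' i w.
  by rewrite (bigD1 j) // finset.mem_pblock cQ inE.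
rewrite !splw Hj mulrBl.
by congr (_ * _ - _ * _); apply: eq_bigr => i /andP[_ /eqH[e1 e2]];
  rewrite ?e1 ?e2.
Qed.

(** One factor k + 1 per block, from [moment_le], times the absolute weight of the partition. *)
Definition cumulant_const (k : nat) : R :=
  \sum_(Q : {set {set 'I_k}} | finset.partition Q [set: 'I_k])
     ((#|Q|.-1)`!%:R * k.+1%:R ^+ #|Q|).

Lemma cumulant_const_ge0 (k : nat) : 0 <= cumulant_const k.
Proof. by apply: sumr_ge0 => Q _; rewrite mulr_ge0 // exprn_ge0. Qed.

Lemma cumulant_le (k : nat) (Y : 'I_k -> T -> R) (n : 'I_k -> R) :
  (forall i, kbounded k (Y i) (n i)) ->
  `|cumulant P Y| <= cumulant_const k * \prod_i n i.
Proof.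
move=> kY; rewrite cumulantE mulr_suml.
apply: le_trans (ler_norm_sum _ _ _) _; apply: ler_sum => Q pQ.
rewrite !normrM normrX normrN1 expr1n mul1r normr_nat -mulrA ler_wpM2l //.
have [/eqP cQ tQ _] := and3P pQ.
have -> : \prod_i n i = \prod_(nu in Q) \prod_(i in nu) n i.
  by rewrite -finset.big_trivIset //= cQ; apply: eq_bigl => i; rewrite inE.
rewrite normr_prod -prodr_const -big_split /=.
apply: ler_prod => nu _; rewrite normr_ge0 /=; apply: moment_le => //.
by rewrite -[leqRHS]card_ord max_card.
Qed.

Definition hybrid (k : nat) (U V : 'I_k -> T -> R) (m : nat) : 'I_k -> T -> R :=
  fun i => if (i < m)%N then U i else V i.

Definition mix (k : nat) (U V : 'I_k -> T -> R) (j : 'I_k) : 'I_k -> T -> R :=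
  fun i => if (i < j)%N then U i else if i == j then (fun w => U i w - V i w) else V i.

(** V is turned into U one slot at a time; by [cumulantB] each change is a cumulant whose slot j
    holds the difference. *)
Lemma cumulant_telescope (k : nat) (U V : 'I_k -> T -> R) (n : 'I_k -> R) :
  (forall i, kbounded k (U i) (n i)) -> (forall i, kbounded k (V i) (n i)) ->
  cumulant P U - cumulant P V = \sum_j cumulant P (mix U V j).
Proof.
move=> kU kV.
have kh m i : kbounded k (hybrid U V m i) (n i) by rewrite /hybrid; case: ifP.
have -> : cumulant P U = cumulant P (hybrid U V k).
  by congr cumulant; apply/funext => i; rewrite /hybrid ltn_ord.
have -> : cumulant P V = cumulant P (hybrid U V 0).
  by congr cumulant; apply/funext => i; rewrite /hybrid.
rewrite -(telescope_sumr (fun m => cumulant P (hybrid U V m))) // big_mkord.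
apply: eq_bigr => j _; apply/esym.
apply: (@cumulantB _ _ _ _ n n j) => // [i ij|w].
  have ij' : (i != j :> nat) by [].
  by rewrite /hybrid /mix ltnS leq_eqVlt (negbTE ij') (negbTE ij).
by rewrite /hybrid /mix ltnS leqnn ltnn eqxx.
Qed.

Lemma kbounded_mix (k : nat) (U V : 'I_k -> T -> R) (n e : 'I_k -> R) (j : 'I_k) :
  (forall i, kbounded k (U i) (n i)) -> (forall i, kbounded k (V i) (n i)) ->
  (forall i, kbounded k (fun w => U i w - V i w) (e i)) ->
  forall i, kbounded k (mix U V j i) (if i == j then e i else n i).
Proof.
move=> kU kV ke i; rewrite /mix; have [->|ij] := eqVneq i j; first by rewrite ltnn.
by case: ifP.
Qed.

Lemma cumulant_mix_le (k : nat) (U V : 'I_k -> T -> R) (n e : 'I_k -> R) (j : 'I_k) :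
  (forall i, kbounded k (U i) (n i)) -> (forall i, kbounded k (V i) (n i)) ->
  (forall i, kbounded k (fun w => U i w - V i w) (e i)) ->
  `|cumulant P (mix U V j)| <= cumulant_const k * (e j * \prod_(i | i != j) n i).
Proof.
move=> kU kV ke; apply: le_trans (cumulant_le (kbounded_mix j kU kV ke)) _.
rewrite ler_wpM2l ?cumulant_const_ge0 // (bigD1 j) //= eqxx.
by rewrite (eq_bigr n) // => i /negbTE ->.
Qed.

Lemma cumulant_diff_le (k : nat) (U V : 'I_k -> T -> R) (n e : 'I_k -> R) :
  (forall i, kbounded k (U i) (n i)) -> (forall i, kbounded k (V i) (n i)) ->
  (forall i, kbounded k (fun w => U i w - V i w) (e i)) ->
  `|cumulant P U - cumulant P V| <=
    cumulant_const k * \sum_j (e j * \prod_(i | i != j) n i).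
Proof.
move=> kU kV ke; rewrite (cumulant_telescope kU kV) mulr_sumr.
apply: le_trans (ler_norm_sum _ _ _) _; apply: ler_sum => j _.
exact: cumulant_mix_le.
Qed.

Definition blend (k : nat) (A : {set 'I_k}) (X Y : 'I_k -> T -> R) : 'I_k -> T -> R :=
  fun i => if i \in A then X i else Y i.

(* Second-order difference: by multilinearity one increment falls in A and one outside. *)
Lemma cumulant_ddiff_le (k : nat) (A : {set 'I_k}) (X1 X0 Y1 Y0 : 'I_k -> T -> R)
    (N : R) (e : 'I_k -> R) :
  (forall i, kbounded k (X1 i) N) -> (forall i, kbounded k (X0 i) N) ->
  (forall i, kbounded k (Y1 i) N) -> (forall i, kbounded k (Y0 i) N) ->
  (forall i, i \in A -> kbounded k (fun w => X1 i w - X0 i w) (e i)) ->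
  (forall i, i \notin A -> kbounded k (fun w => Y1 i w - Y0 i w) (e i)) ->
  `|(cumulant P (blend A X1 Y1) - cumulant P (blend A X1 Y0)) -
    (cumulant P (blend A X0 Y1) - cumulant P (blend A X0 Y0))| <=
  cumulant_const k * N ^+ k.-2 * \sum_(a in A) \sum_(b in ~: A) e a * e b.
Proof.
move=> kX1 kX0 kY1 kY0 eX eY.
(* For k = 0 there is no slot from which [0 <= N] can be read off. *)
have [k0|k0] := posnP k.
  subst k; have bE (X Y X' Y' : 'I_0 -> T -> R) :
     cumulant P (blend A X Y) = cumulant P (blend A X' Y').
    by congr cumulant; apply/funext => -[].
  rewrite (bE X1 Y1 X1 Y0) subrr (bE X0 Y1 X0 Y0) subrr subrr normr0.
  by rewrite mulr_ge0 ?mulr_ge0 ?cumulant_const_ge0 // big1 // => -[].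
have N0 : 0 <= N by have [] := kX1 (Ordinal k0).
have e0 i : 0 <= e i.
  by have [/eX|/eY] := boolP (i \in A); case.
have kb X Y : (forall i, kbounded k (X i) N) -> (forall i, kbounded k (Y i) N) ->
    forall i, kbounded k (blend A X Y i) N by move=> ? ? i; rewrite /blend; case: ifP.
have mX1 i : measurable_fun setT (X1 i) by have [] := kX1 i.
have mX0 i : measurable_fun setT (X0 i) by have [] := kX0 i.
have mY1 i : measurable_fun setT (Y1 i) by have [] := kY1 i.
have mY0 i : measurable_fun setT (Y0 i) by have [] := kY0 i.
pose eB i := if i \in A then 0 else e i.
have keB X : (forall i, measurable_fun setT (X i)) ->
    forall i, kbounded k (fun w => blend A X Y1 i w - blend A X Y0 i w) (eB i).
  move=> mX i; rewrite /blend /eB; case: ifPn => iA; last exact: eY.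
  exact: kbounded_zero.
pose U' := mix (blend A X1 Y1) (blend A X1 Y0).
pose V' := mix (blend A X0 Y1) (blend A X0 Y0).
rewrite (cumulant_telescope (n := fun=> N)); [|exact: kb..].
rewrite (cumulant_telescope (n := fun=> N)); [|exact: kb..].
(* A slot j in A is filled by X in both blends, so its increment is the zero variable and the
   cumulant vanishes. *)
rewrite -sumrB (bigID (fun j => j \in A)) /= big1 ?add0r; last first.
  move=> j jA.
  have z X : (forall i, kbounded k (X i) N) ->
      cumulant P (mix (blend A X Y1) (blend A X Y0) j) = 0.
    move=> kX; apply/eqP; rewrite -normr_le0.
    have mX i : measurable_fun setT (X i) by have [] := kX i.
    apply: le_trans (cumulant_mix_le j (kb _ _ kX kY1) (kb _ _ kX kY0) (keB _ mX)) _.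
    by rewrite /eB jA mul0r mulr0.
  by rewrite !z // subrr.
apply: le_trans (ler_norm_sum _ _ _) _.
rewrite exchange_big /= mulr_sumr.
rewrite [leRHS](eq_bigl (fun j => j \notin A)); last by move=> j; rewrite inE.
apply: ler_sum => j jA.
have kU' := kbounded_mix j (kb _ _ kX1 kY1) (kb _ _ kX1 kY0) (keB _ mX1).
have kV' := kbounded_mix j (kb _ _ kX0 kY1) (kb _ _ kX0 kY0) (keB _ mX0).
pose e' i := if i \in A then e i else 0.
have ke' i : kbounded k (fun w => U' j i w - V' j i w) (e' i).
  have mU' := let: And3 m _ _ := kU' i in m.
  rewrite /e'; case: ifPn => iA.
    rewrite /U' /V' /mix /blend iA; case: ifP => _; first exact: eX.
    have ij : (i == j) = false by apply/negbTE; apply: contraNneq jA => <-.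
    by rewrite ij; exact: eX.
  have -> : V' j i = U' j i by rewrite /U' /V' /mix /blend (negbTE iA).
  exact: kbounded_zero.
(* Slot j already holds an increment of Y; the second telescoping, between X1 and X0, puts another
   one at some a in A. *)
apply: le_trans (cumulant_diff_le kU' kV' ke') _.
rewrite -mulrA ler_wpM2l ?cumulant_const_ge0 // mulr_sumr.
rewrite (bigID (fun a => a \in A)) /= [X in _ + X]big1 ?addr0; last first.
  by move=> a aA; rewrite /e' (negbTE aA) mul0r.
apply: ler_sum => a aA; rewrite /e' aA.
have aj : j != a by apply: contraNneq jA => ->.
rewrite (bigD1 j) //= eqxx /eB (negbTE jA).
rewrite (eq_bigr (fun=> N)); last by move=> i /andP[_ /negbTE ->].
(* Slots a and j hold increments; the other k - 2 keep the bound N. *)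
have ck : #|[predD1 predC1 a & j]| = k.-2.
  have := cardD1 j (predC1 a); rewrite inE aj cardC1 card_ord /= => ->.
  by rewrite add1n.
rewrite prodr_const (_ : #|_| = k.-2) ?[N ^+ _ * _]mulrC ?mulrA //.
by rewrite -ck; apply: eq_card => i; rewrite !inE andbC.
Qed.

Lemma cumulant_indep_eq0 (k : nat) (A : {set 'I_k}) (Y : 'I_k -> T -> R) :
  A != finset.set0 -> A != [set: 'I_k]%SET ->
  (forall nu : {set 'I_k},
     moment Y nu = moment Y (nu :&: A)%SET * moment Y (nu :\: A)%SET) ->
  cumulant P Y = 0.
Proof.
move=> A0 AT mY; rewrite cumulantE.
by apply: (cumulant_indep (A := A) (a := moment Y) (b := moment Y)) => //; exact: moment0.
Qed.

Lemma eq_cumulant (k : nat) (Y Y' : 'I_k -> T -> R) :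
  (forall nu, moment Y nu = moment Y' nu) -> cumulant P Y = cumulant P Y'.
Proof.
move=> YY'; rewrite !cumulantE; apply: eq_bigr => Q _; congr (_ * _).
by apply: eq_bigr => nu _.
Qed.

End Moments.

(** * Resampling the remote past *)

Section Resampling.
Local Open Scope classical_set_scope.
Local Open Scope ring_scope.
Import numFieldNormedType.Exports HBSimple.

(** Convergence to 0 of nonnegative extended reals, in a form that lets early terms be infinite. *)
Definition evsmall {R : realType} (a : nat -> \bar R) : Prop :=
  forall eta : R, 0 < eta -> exists N, forall u, (N <= u)%N -> (a u <= eta%:E)%E.

Lemma cvg0_evsmall {R : realType} (a : nat -> \bar R) :
  (a @ \oo --> 0%E) -> evsmall a.
Proof.
move=> /fine_cvgP[[N1 _ a1]] /cvgrPdist_le a2 eta eta0.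
have [N2 _ {}a2] := a2 _ eta0; exists (maxn N1 N2) => u; rewrite geq_max => /andP[u1 u2].
rewrite -[a u]fineK; last exact: a1.
by rewrite lee_fin (le_trans (ler_norm _)) // -[X in `|X|]opprK normrN -sub0r; exact: a2.
Qed.

(* Reduces L^k convergence of g to L^1 convergence of g |g|^(k-1). *)
Lemma exprB_le {R : realType} (k : nat) (a b : R) : (0 < k)%N ->
  `|a - b| ^+ k <= 2 ^+ k * `|a * `|a| ^+ k.-1 - b * `|b| ^+ k.-1|.
Proof.
case: k => // k _ /=.
have pos (x y : R) : 0 <= y -> y <= x ->
    `|x - y| ^+ k.+1 <= 2 ^+ k.+1 * `|x * `|x| ^+ k - y * `|y| ^+ k|.
  move=> y0 yx; have x0 : 0 <= x by apply: le_trans yx.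
  rewrite !ger0_norm // -?exprS ?subr_ge0 ?lerXn2r ?nnegrE //.
  (* Superadditivity of powers on the nonnegative reals settles the case of equal signs. *)
  have sup : (x - y) ^+ k.+1 + y ^+ k.+1 <= x ^+ k.+1.
    rewrite -[in leRHS](subrK y x); elim: (k) => [|m IH]; first by rewrite !expr1.
    have z0 : 0 <= x - y by rewrite subr_ge0.
    rewrite [leRHS]exprS.
    apply: (@le_trans _ _ ((x - y + y) * ((x - y) ^+ m.+1 + y ^+ m.+1))); last first.
      by rewrite ler_wpM2l // addr_ge0.
    rewrite -subr_ge0 !(exprS _ m.+1).
    rewrite (_ : _ - _ = (x - y) * y ^+ m.+1 + y * (x - y) ^+ m.+1); last by ring.
    by rewrite addr_ge0 // mulr_ge0 // exprn_ge0.
  apply: (@le_trans _ _ (x ^+ k.+1 - y ^+ k.+1)); first by rewrite lerBrDr.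
  rewrite ler_peMl ?exprn_ege1 ?ler1n // subr_ge0 lerXn2r ?nnegrE //.
have opp (x y : R) : 0 <= x -> y <= 0 ->
    `|x - y| ^+ k.+1 <= 2 ^+ k.+1 * `|x * `|x| ^+ k - y * `|y| ^+ k|.
  move=> x0 y0; have y0' : 0 <= - y by rewrite oppr_ge0.
  rewrite -mulNr (ger0_norm x0) (ler0_norm y0) -!exprS.
  rewrite ger0_norm ?addr_ge0 // [X in _ * X]ger0_norm ?addr_ge0 ?exprn_ge0 //.
  (* For opposite signs the distance is a sum, at most twice its larger term: the origin of the
     power of 2. *)
  have key (u v : R) : 0 <= u -> u <= v -> (u + v) ^+ k.+1 <= 2 ^+ k.+1 * (u ^+ k.+1 + v ^+ k.+1).
    move=> u0 uv; have v0 := le_trans u0 uv.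
    apply: (@le_trans _ _ ((2 * v) ^+ k.+1)).
      by rewrite lerXn2r ?nnegrE ?addr_ge0 ?mulr_ge0 // mulr_natl mulr2n lerD2r.
    by rewrite exprMn ler_wpM2l ?exprn_ge0 // lerDr exprn_ge0.
  have [xy|/ltW yx] := leP x (- y); first exact: key.
  by rewrite addrC [X in _ * X]addrC; exact: key.
have sym (x y : R) : `|x - y| = `|- x - - y| by rewrite -normrN opprB opprK addrC.
have swap (x y : R) : `|x - y| ^+ k.+1 <= 2 ^+ k.+1 * `|x * `|x| ^+ k - y * `|y| ^+ k| ->
    `|y - x| ^+ k.+1 <= 2 ^+ k.+1 * `|y * `|y| ^+ k - x * `|x| ^+ k|.
  by rewrite distrC [X in _ <= _ * X]distrC.
have neg (x y : R) :
    `|- x - - y| ^+ k.+1 <= 2 ^+ k.+1 * `|- x * `|- x| ^+ k - - y * `|- y| ^+ k| ->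
    `|x - y| ^+ k.+1 <= 2 ^+ k.+1 * `|x * `|x| ^+ k - y * `|y| ^+ k|.
  by rewrite -sym !normrN !mulNr -sym.
have [a0|/ltW a0] := leP 0 a; have [b0|/ltW b0] := leP 0 b.
- have [ab|/ltW ba] := leP a b; last exact: pos.
  exact/swap/pos.
- exact: opp.
- exact/swap/opp.
- apply: neg; have a0' : 0 <= - a by rewrite oppr_ge0.
  have b0' : 0 <= - b by rewrite oppr_ge0.
  have [ab|/ltW ba] := leP a b; first by apply: pos => //; rewrite lerN2.
  by apply/swap/pos => //; rewrite lerN2.
Qed.

Context {dT} {T : measurableType dT} {R : realType} (P : probability T R).
Context {dE} {E : measurableType dE} {J : choiceType} (xi : J -> T -> E).
Hypothesis mxi : forall i, measurable_fun setT (xi i).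
Hypothesis ind : mutually_independent P xi.
Hypothesis eqmarg : forall i j A, measurable A -> P (xi i @^-1` A) = P (xi j @^-1` A).

Definition pull (s : nat -> J) (w : T) : nat -> E := fun j => xi (s j) w.

Lemma measurable_pull {d} {U : sigmaRingType d} (f : (nat -> E) -> U) (s : nat -> J) :
  prod_measurable f -> measurable_fun setT (fun w => f (pull s w)).
Proof.
move=> mf; apply: (measurable_comp measurableT _ mf) => //.
exact: (@measurable_prodType nat _ E _ T (fun j => xi (s j))).
Qed.

Variables (sigma : nat -> nat -> J) (sigmaoo : nat -> J).
Hypothesis sI : forall u, injective (sigma u).
Hypothesis sooI : injective sigmaoo.
Hypothesis cvs : forall j, exists N, forall u, (N <= u)%N -> sigma u j = sigmaoo j.

(** Functions for which the passage to the limit holds in L^1. Indicators of cylinders qualify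
    because each coordinate is eventually read at its final label; closure properties then lead to
    every function integrable along [sigmaoo]. *)
Let L1cvg (f : (nat -> E) -> R) : Prop := prod_measurable f /\
  evsmall (fun u => \int[P]_w (`|f (pull (sigma u) w) - f (pull sigmaoo w)|)%:E)%E.

Let measurable_dist (f f' : (nat -> E) -> R) (s s' : nat -> J) :
  prod_measurable f -> prod_measurable f' ->
  measurable_fun setT (fun w => (`|f (pull s w) - f' (pull s' w)|)%:E).
Proof.
move=> mf mf'; apply/measurable_EFinP; apply: measurableT_comp => //.
by apply: measurable_funB; exact: measurable_pull.
Qed.

(** Control of the oscillation suffices, so this serves complements, finite unions and linear
    combinations alike. *)
Let L1cvg_le (f f1 f2 : (nat -> E) -> R) (c1 c2 : R) : 0 <= c1 -> 0 <= c2 ->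
  prod_measurable f -> L1cvg f1 -> L1cvg f2 ->
  (forall y y', `|f y - f y'| <= c1 * `|f1 y - f1 y'| + c2 * `|f2 y - f2 y'|) ->
  L1cvg f.
Proof.
move=> c10 c20 mf [m1 e1] [m2 e2] H; split => // eta eta0.
(* The extra 1 keeps the divisor positive when both constants vanish. *)
have d0 : 0 < c1 + c2 + 1 by rewrite ltr_wpDl // addr_ge0.
have eta'0 : 0 < eta / (c1 + c2 + 1) by rewrite divr_gt0.
have [N1 {}e1] := e1 _ eta'0; have [N2 {}e2] := e2 _ eta'0.
exists (maxn N1 N2) => u; rewrite geq_max => /andP[/e1{}e1 /e2{}e2].
set I1 := (\int[P]_w _)%E in e1; set I2 := (\int[P]_w _)%E in e2.
apply: (@le_trans _ _ (c1%:E * I1 + c2%:E * I2)%E).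
  rewrite /I1 /I2 -!ge0_integralZl //; try exact: measurable_dist; try by rewrite lee_fin.
  rewrite -ge0_integralD //; first last.
  - by apply: measurable_funeM; exact: measurable_dist.
  - by move=> w _; rewrite -EFinM lee_fin mulr_ge0.
  - by apply: measurable_funeM; exact: measurable_dist.
  - by move=> w _; rewrite -EFinM lee_fin mulr_ge0.
  apply: ge0_le_integral => //; first exact: measurable_dist.
  - by apply: emeasurable_funD; apply: measurable_funeM; exact: measurable_dist.
  - by move=> w _; rewrite -!EFinM -EFinD lee_fin.
apply: (@le_trans _ _ (c1%:E * (eta / (c1 + c2 + 1))%:E + c2%:E * (eta / (c1 + c2 + 1))%:E)%E).
  by apply: leeD; apply: lee_wpmul2l; rewrite ?lee_fin.
rewrite -!EFinM -EFinD lee_fin -mulrDl mulrCA ler_piMr ?(ltW eta0) //.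
by rewrite ler_pdivrMr // mul1r lerDl.
Qed.

(** The sequences read through [sigma u] and [sigmaoo] have the same law, so an approximation at the
    limit is equally good at every u; three errors of eta / 3 add up. *)
Let L1cvg_closure (f : (nat -> E) -> R) : prod_measurable f ->
  (forall eta : R, 0 < eta -> exists2 f', L1cvg f' &
     (\int[P]_w (`|f (pull sigmaoo w) - f' (pull sigmaoo w)|)%:E <= eta%:E)%E) ->
  L1cvg f.
Proof.
move=> mf H; split => // eta eta0.
have eta3 : 0 < eta / 3 by rewrite divr_gt0.
have [f' [mf' ef'] ff'] := H _ eta3.
have [N ef'N] := ef' _ eta3; exists N => u /ef'N {}ef'N.
have ff'u : (\int[P]_w (`|f (pull (sigma u) w) - f' (pull (sigma u) w)|)%:E <= (eta / 3)%:E)%E.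
  rewrite (_ : (\int[P]_w _ = \int[P]_w (`|f (pull sigmaoo w) - f' (pull sigmaoo w)|)%:E)%E) //.
  apply: (iid_law mxi ind eqmarg (F := fun y => (`|f y - f' y|)%:E) (@sI u) sooI).
  apply/measurable_EFinP; apply: measurableT_comp => //.
  exact: measurable_funB.
have -> : eta%:E = (eta / 3)%:E + ((eta / 3)%:E + (eta / 3)%:E) :> \bar R.
  by rewrite -!EFinD; congr (_%:E); rewrite -!mulrDl -[X in X / 3](_ : eta * 3 = _) ?mulfK //; ring.
apply: le_trans (leeD ff'u (leeD ef'N ff')).
rewrite -!ge0_integralD //; try exact: measurable_dist; first last.
- by apply: emeasurable_funD; exact: measurable_dist.
- by move=> w _; rewrite adde_ge0.
apply: ge0_le_integral => //; first exact: measurable_dist.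
- apply: emeasurable_funD; first exact: measurable_dist.
  by apply: emeasurable_funD; exact: measurable_dist.
- move=> w _; rewrite -!EFinD lee_fin.
  set a := f _; set b := f _; set a' := f' _; set b' := f' _.
  rewrite [`|b - b'|]distrC.
  rewrite (_ : a - b = (a - a') + ((a' - b') + (b' - b))); last by ring.
  by apply: le_trans (ler_normD _ _) _; rewrite lerD2l; exact: ler_normD.
Qed.

Let i1 (B : set (prodType nat E)) (y : nat -> E) : R := \1_B y.

Let i1E B y : i1 B y = (y \in B)%:R. Proof. by rewrite /i1 indicE. Qed.

Let measurable_i1 B : measurable B -> prod_measurable (i1 B).
Proof. by move=> mB; exact: (@measurable_indic _ (prodType nat E) R setT B). Qed.

Let L1cvg_indic (B0 : set (prodType nat E)) : measurable B0 -> L1cvg (i1 B0).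
Proof.
(* The good sets form a sigma-algebra that contains the cylinders. *)
suff : @measurable _ (prodType nat E) `<=` [set B : set (prodType nat E) | measurable B /\ L1cvg (i1 B)].
  by move=> H /H[].
apply: smallest_sub; first split.
- split; first exact: measurable0.
  split; first exact: measurable_i1.
  move=> eta eta0; exists 0%N => u _.
  by under eq_integral do rewrite !i1E !in_set0 subrr normr0; rewrite integral0 lee_fin ltW.
- move=> B [mB cB]; rewrite setTD; have mC := measurableC mB; split => //.
  apply: (L1cvg_le (c1 := 1) (c2 := 0) _ _ _ cB cB) => //; first exact: measurable_i1.
  move=> y y'; rewrite mul0r addr0 mul1r !i1E !in_setC.
  by case: (y \in B); case: (y' \in B); rewrite ?subrr ?normr0 ?subr0 ?sub0r ?normrN.
- move=> F mF; have mU : measurable (\bigcup_n F n : set (prodType nat E)).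
    by apply: bigcupT_measurable => n; have [] := mF n.
  split => //.
  have mK K : measurable (\big[setU/set0]_(n < K) F n : set (prodType nat E)).
    by apply: bigsetU_measurable => n _; have [] := mF n.
  have cK K : L1cvg (i1 (\big[setU/set0]_(n < K) F n)).
    elim: K => [|K IH].
      rewrite big_ord0; split; first exact: measurable_i1.
      move=> eta eta0; exists 0%N => u _.
      by under eq_integral do rewrite !i1E !in_set0 subrr normr0; rewrite integral0 lee_fin ltW.
    have [_ cF] := mF K.
    apply: (L1cvg_le (c1 := 1) (c2 := 1) _ _ _ IH cF) => //; first exact: measurable_i1.
    move=> y y'; rewrite big_ord_recr /= !mul1r !i1E !in_setU.
    case: (y \in F K); case: (y' \in F K); case: (y \in _); case: (y' \in _);
      rewrite /= ?subrr ?normr0 ?subr0 ?sub0r ?normrN ?normr1 ?addr0 ?add0r ?lerDl //.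
  (* Finite unions are good by induction and approximate the countable one in L^1 by dominated
     convergence. *)
  apply: (L1cvg_closure (measurable_i1 mU)).
  move=> eta eta0.
  pose FU (n : nat) : T -> \bar R := fun w =>
    (i1 (\big[setU/set0]_(i < n) F i) (pull sigmaoo w))%:E.
  pose FF : T -> \bar R := fun w => (i1 (\bigcup_n F n) (pull sigmaoo w))%:E.
  have mi (B : set (prodType nat E)) : measurable B ->
      measurable_fun setT (fun w => (i1 B (pull sigmaoo w))%:E).
    move=> mB; apply/measurable_EFinP.
    by apply: (measurable_pull (f := i1 B)); exact: measurable_i1.
  have := @dominated_convergence _ T R P setT measurableT FU FF (cst 1%E).
  case.
  - by move=> n; exact: mi.
  - exact: mi.
  - apply: aeW => w _; rewrite /FU /FF.
    have [[n _ Fn]|nF] := pselect ((\bigcup_n F n) (pull sigmaoo w)).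
      apply: cvg_near_cst; exists n.+1 => // m /= nm.
      have inK : pull sigmaoo w \in \big[setU/set0]_(i < m) F i.
        by rewrite inE -bigcup_mkord; exists n.
      have inU : pull sigmaoo w \in \bigcup_n F n by rewrite inE; exists n.
      by rewrite !i1E inK inU.
    apply: cvg_near_cst; exists 0%N => // m _ /=.
    have inK : (pull sigmaoo w \in \big[setU/set0]_(i < m) F i) = false.
      apply/negbTE; rewrite notin_setE -bigcup_mkord => -[i _ Fi].
      by apply: nF; exists i.
    have inU : (pull sigmaoo w \in \bigcup_n F n) = false.
      by apply/negbTE; rewrite notin_setE.
    by rewrite !i1E inK inU.
  - exact: finite_measure_integrable_cst.
  - apply: aeW => w n _; rewrite /FU lee_fin i1E.
    by case: (_ \in _); rewrite ?normr1 ?normr0.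
  move=> _ /cvg0_evsmall /(_ _ eta0)[K HK] _.
  exists (i1 (\big[setU/set0]_(n < K) F n)) => //.
  apply: le_trans (HK K (leqnn _)); rewrite le_eqVlt; apply/orP; left; apply/eqP.
  by apply: eq_integral => w _; rewrite /FU /FF -EFinB /= distrC.
- move=> _ [j [A [mA ->]]].
  have mj : measurable ((fun s : prodType nat E => s j) @^-1` A).
    by rewrite -[X in measurable X]setTI; exact: measurable_coord.
  split => //; split; first exact: measurable_i1.
  move=> eta eta0; have [N HN] := cvs j; exists N => u /HN su.
  have eqi w : i1 [set s | A (s j)] (pull (sigma u) w) =
               i1 [set s | A (s j)] (pull sigmaoo w).
    by rewrite !i1E /pull; congr (nat_of_bool _)%:R; apply/idP/idP;
      rewrite !inE /= su.
  under eq_integral => w _ do rewrite eqi subrr normr0.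
  by rewrite integral0 lee_fin ltW.
Qed.

(** The simple functions are taken on the sequence space, under the law of the limit sequence, so
    that they can be evaluated along every [sigma u] as well. *)
Let L1cvg_integrable (f : (nat -> E) -> R) : prod_measurable f ->
  P.-integrable setT (fun w => (f (pull sigmaoo w))%:E) -> L1cvg f.
Proof.
move=> mf intf; apply: L1cvg_closure => // eta eta0.
have mp : measurable_fun setT (pull sigmaoo : T -> prodType nat E).
  exact: (@measurable_prodType nat _ E _ T (fun j => xi (sigmaoo j))).
have mfE : measurable_fun [set: prodType nat E] (fun y => (f y)%:E).
  exact/measurable_EFinP.
have intf' := integrable_pushforward mp (mu := P) mfE intf measurableT.
have [phi [_ _ /cvg0_evsmall /(_ _ eta0)[N /(_ N (leqnn _)) HN]]] :=
  approximation_sfun_integrable measurableT intf'.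
pose phiN (y : nat -> E) : R := phi N y.
exists phiN.
  have phiE : phiN = fun y =>
      \sum_(x <- finmap.enum_fset (fset_set (range (phi N)))) x * i1 (phi N @^-1` [set x]) y.
    by apply/funext => y; rewrite /phiN fimfunE fsbig_finite.
  rewrite phiE.
  have mphi x : measurable (phi N @^-1` [set x] : set (prodType nat E)).
    exact: measurable_funPTI.
  elim: (finmap.enum_fset _) => [|x s IH].
    under eq_fun do rewrite big_nil.
    split; first exact: measurable_cst.
    move=> e e0; exists 0%N => u _.
    by under eq_integral do rewrite subrr normr0; rewrite integral0 lee_fin ltW.
  apply: (L1cvg_le (c1 := `|x|) (c2 := 1) _ _ _ (L1cvg_indic (mphi x)) IH) => //.
    under eq_fun do rewrite big_cons.
    apply: measurable_funD; last by case: IH.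
    by apply: measurable_funM => //; exact: measurable_i1.
  move=> y y'; rewrite !big_cons mul1r -normrM mulrBr.
  rewrite [X in `|X|](_ : _ =
    (x * i1 (phi N @^-1` [set x]) y - x * i1 (phi N @^-1` [set x]) y') +
    (\sum_(j <- s) j * i1 (phi N @^-1` [set j]) y -
     \sum_(j <- s) j * i1 (phi N @^-1` [set j]) y')); last by ring.
  exact: ler_normD.
move: HN; rewrite ge0_integral_pushforward //; last first.
  by apply: measurableT_comp => //; apply: emeasurable_funB => //; exact/measurable_EFinP.
Qed.

Lemma resample_Lk_cvg (k : nat) (g : (nat -> E) -> R) : (0 < k)%N ->
  prod_measurable g ->
  (\int[P]_w (`|g (pull sigmaoo w)| ^+ k)%:E < +oo)%E ->
  evsmall (fun u => \int[P]_w (`|g (pull (sigma u) w) - g (pull sigmaoo w)| ^+ k)%:E)%E.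
Proof.
move=> k0 mg gfin.
pose f y := g y * `|g y| ^+ k.-1.
have mf : prod_measurable f.
  apply: measurable_funM => //.
  by apply: (@measurable_funX _ (prodType nat E) _ _ (fun y => `|g y|)); exact: measurableT_comp.
have [_ ef] : L1cvg f.
  apply: L1cvg_integrable => //; apply/integrableP; split.
    by apply/measurable_EFinP; exact: measurable_pull.
  apply: le_lt_trans gfin; rewrite le_eqVlt; apply/orP; left; apply/eqP.
  apply: eq_integral => w _; rewrite /= /f normrM normrX normr_id -exprS prednK //.
move=> eta eta0.
have [N HN] := ef (eta / 2 ^+ k) (divr_gt0 eta0 (exprn_gt0 k (ltr0n _ 2))).
exists N => u /HN {}HN.
have -> : eta%:E = ((2 ^+ k)%:E * (eta / 2 ^+ k)%:E)%E :> \bar R.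
  by rewrite -EFinM mulrC mulfVK // expf_neq0.
apply: le_trans (lee_wpmul2l _ HN); last by rewrite lee_fin exprn_ge0.
rewrite -ge0_integralZl //; last exact: measurable_dist.
apply: ge0_le_integral => //.
- apply: measurable_normX.
  by apply: measurable_funB; exact: measurable_pull.
- by apply: measurable_funeM; exact: measurable_dist.
- by move=> w _; rewrite -EFinM lee_fin; exact: exprB_le.
Qed.

End Resampling.

(** * Cumulants across a gap *)

Section SplitBound.
Local Open Scope classical_set_scope.
Local Open Scope ring_scope.
Context {dT} {T : measurableType dT} {R : realType} (P : probability T R).
Context {dE} {E : measurableType dE} (xi : bool * int -> T -> E).
Hypothesis mxi : forall i, measurable_fun setT (xi i).
Hypothesis ind : mutually_independent P xi.
Hypothesis eqmarg : forall i j A, measurable A -> P (xi i @^-1` A) = P (xi j @^-1` A).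
Variable g : (nat -> E) -> R.
Hypothesis mg : prod_measurable g.
Variable k : nat.
Hypothesis k0 : (0 < k)%N.

(* [shifted rho t] is X_t computed from the innovations [xi (rho m)] in place of eps_m. *)
Definition shifted (rho : int -> bool * int) (t : int) : T -> R :=
  fun w => g (pull xi (fun j : nat => rho (t - j%:Z)) w).

(** The relabelling under which [shifted] becomes [bshift_star]. *)
Definition single_swap (m : int) : bool * int := if m == 0 then (false, 0) else (true, m).

(** [M] bounds $\|X_0\|_k$ and [n i] bounds $\delta_k(i)$. *)
Variables (M : R) (n : nat -> R).
Hypothesis M0 : 0 <= M.
Hypothesis intM :
  (\int[P]_w (`|shifted (pair true) 0 w| ^+ k)%:E <= (M ^+ k)%:E)%E.
Hypothesis n0 : forall i, 0 <= n i.
Hypothesis intn : forall i : nat,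
  (\int[P]_w (`|shifted (pair true) i%:Z w - shifted single_swap i%:Z w| ^+ k)%:E
     <= (n i ^+ k)%:E)%E.

Lemma shift_inj (rho : int -> bool * int) (t : int) : injective rho ->
  injective (fun j : nat => rho (t - j%:Z)).
Proof. by move=> rI i j /rI; lia. Qed.

Lemma measurable_shifted rho t : measurable_fun setT (shifted rho t).
Proof. exact: measurable_pull. Qed.

(** An injective relabelling reads distinct innovations, so the variable has the law of $X_0$
    whatever t is. *)
Lemma kbounded_shifted rho t : injective rho -> kbounded P k (shifted rho t) M.
Proof.
move=> rI; split => //; first exact: measurable_shifted.
apply: le_trans intM; rewrite le_eqVlt; apply/orP; left; apply/eqP.
have pI : injective (pair true : int -> bool * int) by move=> ? ? [].
apply: (iid_law mxi ind eqmarg (F := fun y => (`|g y| ^+ k)%:E)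
  (shift_inj (t := t) rI) (shift_inj (t := 0) pI)).
apply/measurable_EFinP.
by apply: (@measurable_funX _ (prodType nat E) _ _ (fun y => `|g y|)); exact: measurableT_comp.
Qed.

(** Zero at negative lags, since $X_t$ does not read innovations later than t. *)
Definition nz (m : int) : R := if m is Posz i then n i else 0.

Lemma nz_ge0 m : 0 <= nz m. Proof. by case: m => //= i; exact: n0. Qed.

(** The label [rho' c] is fresh for [rho], so for $i=t-c\ge0$ the two variables have the joint law
    of $X_i$ and $X_i^*$; for t < c they coincide. *)
Lemma kbounded_swap (rho rho' : int -> bool * int) (c t : int) :
  injective rho -> injective rho' -> (forall m, m != c -> rho m = rho' m) ->
  (forall m, rho m != rho' c) ->
  kbounded P k (fun w => shifted rho t w - shifted rho' t w) (nz (t - c)).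
Proof.
move=> rI r'I rr' rc; split; [|exact: nz_ge0|].
  by apply: measurable_funB; exact: measurable_shifted.
case tc : (t - c) => [i|i] /=; last first.
  have -> : shifted rho t = shifted rho' t.
    apply/funext => w; congr g; apply/funext => j; rewrite /pull rr' //.
    by move: tc => /eqP; lia.
  under eq_integral do rewrite subrr normr0.
  by rewrite !expr0n gtn_eqF //= integral0.
apply: le_trans (intn i); rewrite le_eqVlt; apply/orP; left; apply/eqP.
(* [None] stands for the replacement of the innovation at c; both differences are then the same
   function of an i.i.d. family indexed by [option int]. *)
pose F (y : option int -> E) :=
  (`|g (fun j : nat => y (Some (i%:Z - j%:Z))) -
     g (fun j : nat => y (if i%:Z - j%:Z == 0 then None else Some (i%:Z - j%:Z)))| ^+ k)%:E.
pose u (o : option int) := if o is Some m then rho (m + c) else rho' c.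
pose v (o : option int) : bool * int := if o is Some m then (true, m) else (false, 0).
have uI : injective u.
  move=> [a|] [b|] //=.
  - by move=> /rI ab; congr Some; lia.
  - by move/eqP; rewrite (negbTE (rc _)).
  - by move/esym/eqP; rewrite (negbTE (rc _)).
have vI : injective v by move=> [a|] [b|] //= [->].
have mF : prod_measurable F.
  apply: measurable_normX; apply: measurable_funB.
    apply: (measurable_comp measurableT _ mg) => //.
    exact: (@measurable_reindex (option int) nat _ E (fun j : nat => Some (i%:Z - j%:Z))).
  apply: (measurable_comp measurableT _ mg) => //.
  exact: (@measurable_reindex (option int) nat _ E
    (fun j : nat => if i%:Z - j%:Z == 0 then None else Some (i%:Z - j%:Z))).
have := iid_law mxi ind eqmarg uI vI mF.
rewrite /F /u /v /shifted /pull.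
congr (_ = _); apply: eq_integral => w _; congr (`|g _ - g _| ^+ k)%:E.
- by apply/funext => j; congr (xi (rho _)); move: tc => /eqP; lia.
- apply/funext => j; case: eqP => [ij|ij]; first by congr (xi (rho' _)); move: tc => /eqP; lia.
  rewrite (_ : t - j%:Z = i%:Z - j%:Z + c); last by move: tc => /eqP; lia.
  by rewrite rr' //; apply/eqP; lia.
- by apply/funext => j; rewrite /single_swap; case: eqP.
Qed.

Lemma moment_relabel (I : finType) (rho : I -> int -> bool * int) (t : I -> int)
    (pi : bool * int -> bool * int) (nu : {set I}) : injective pi ->
  moment P (fun i => shifted (rho i) (t i)) nu =
  moment P (fun i => shifted (fun m => pi (rho i m)) (t i)) nu.
Proof.
move=> piI; congr fine.
pose F (y : bool * int -> E) :=
  (\prod_(i in nu) g (fun j : nat => y (rho i (t i - j%:Z))))%:E.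
apply: (iid_law mxi ind eqmarg (F := F) (u := id) (v := pi)) => //.
apply/measurable_EFinP.
apply: (@measurable_prod_in _ (prodType (bool * int) E)) => i _.
apply: (measurable_comp measurableT _ mg) => //.
exact: (@measurable_reindex (bool * int) nat _ E (fun j : nat => rho i (t i - j%:Z))).
Qed.

(** * Refreshing the past of the later block *)

Section Split.
Variables (t : 'I_k -> int) (s : int).

Let A : {set 'I_k} := [set i | t i <= s]%SET.

Let rhoA : int -> bool * int := pair true.
(** The copy with index s + 1 is read by neither [rhoB] nor [rhooo], so this substitute is
    independent of every refresh in the later block. *)
Let rhoF (c m : int) : bool * int := if m == c then (false, s + 1) else (true, m).
(** The strict lower bound means that stage u has replaced exactly u innovations, and that the step
    to stage u + 1 treats the index s - u. *)
Let rhoB (u : nat) (m : int) : bool * int :=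
  if (s - u%:Z < m) && (m <= s) then (false, m) else (true, m).
Let rhooo (m : int) : bool * int := if m <= s then (false, m) else (true, m).

Let fam (rho : int -> bool * int) (i : 'I_k) := shifted rho (t i).

Let rhoA_inj : injective rhoA. Proof. by move=> ? ? []. Qed.
Let rhoF_inj c : injective (rhoF c).
Proof. by move=> a b; rewrite /rhoF; case: eqP => [->|?]; case: eqP => // ? []. Qed.
Let rhoB_inj u : injective (rhoB u).
Proof. by move=> a b; rewrite /rhoB; case: ifP; case: ifP => // _ _ []. Qed.
Let rhooo_inj : injective rhooo.
Proof. by move=> a b; rewrite /rhooo; case: ifP; case: ifP => // _ _ []. Qed.

Let blendE a b : blend A (fam a) (fam b) =
  fun i => shifted (if i \in A then a else b) (t i).
Proof. by apply/funext => i; rewrite /blend /fam; case: ifP. Qed.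

Let kbounded_blend a b : injective a -> injective b ->
  forall i, kbounded P k (blend A (fam a) (fam b) i) M.
Proof. by move=> aI bI i; rewrite blendE; case: ifP => _; exact: kbounded_shifted. Qed.

(* Exchanging eps_c and eps'_c is invisible to the A-block once its eps_c is refreshed. *)
Let cumulant_exchange (u : nat) :
  cumulant P (blend A (fam (rhoF (s - u%:Z))) (fam (rhoB u))) =
  cumulant P (blend A (fam (rhoF (s - u%:Z))) (fam (rhoB u.+1))).
Proof.
pose c := s - u%:Z.
(* Exchanges the two copies at c. The A-block reads neither, its substitute having index s + 1 > c,
   while stage u of the later block becomes stage u + 1. *)
pose pi (x : bool * int) : bool * int := if x.2 == c then (~~ x.1, x.2) else x.
have piI : injective pi.
  move=> [b m] [b' m']; rewrite /pi /=; case: eqP => [->|mc]; case: eqP => [->|m'c] //.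
  - by move=> [/negb_inj ->].
  - by move=> [_ /esym].
  - by move=> [_ ].
apply: eq_cumulant => nu; rewrite !blendE (moment_relabel _ _ _ piI).
congr (moment P _ nu); apply/funext => i; congr (shifted _ (t i)).
apply/funext => m; case: ifP => _.
  rewrite /rhoF -/c /pi; have [_|mc] := eqVneq m c; last by rewrite /= (negbTE mc).
  by rewrite /= /c; case: eqP => //; lia.
rewrite /rhoB /pi.
have [->|mc] := eqVneq m c.
  have -> : (s - u%:Z < c) && (c <= s) = false by rewrite /c; lia.
  have -> : (s - u.+1%:Z < c) && (c <= s) = true by rewrite /c; lia.
  by rewrite /= eqxx.
have -> : (s - u.+1%:Z < m) && (m <= s) = (s - u%:Z < m) && (m <= s).
  by move/eqP: mc; rewrite /c; lia.
by case: ((s - u%:Z < m) && (m <= s)) => /=; rewrite (negbTE mc).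
Qed.

Let cumulant_step (u : nat) :
  `|cumulant P (blend A (fam rhoA) (fam (rhoB u))) -
    cumulant P (blend A (fam rhoA) (fam (rhoB u.+1)))| <=
  cumulant_const k * M ^+ k.-2 *
    \sum_(a in A) \sum_(b in ~: A) nz (t a - (s - u%:Z)) * nz (t b - (s - u%:Z)).
Proof.
pose c := s - u%:Z.
have ex := cumulant_exchange u; rewrite -/c in ex.
(* The subtracted 0, written as the difference that [cumulant_exchange] makes vanish, completes the
   double difference. *)
rewrite -[X in `|X|]subr0.
rewrite -[X in _ - X](subrr (cumulant P (blend A (fam (rhoF c)) (fam (rhoB u))))).
rewrite [X in _ - (_ - X)]ex.
apply: (cumulant_ddiff_le (e := fun i => nz (t i - c))).
- by move=> i; apply: kbounded_shifted; exact: rhoA_inj.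
- by move=> i; apply: kbounded_shifted; exact: rhoF_inj.
- by move=> i; apply: kbounded_shifted; exact: rhoB_inj.
- by move=> i; apply: kbounded_shifted; exact: rhoB_inj.
- move=> i _; apply: kbounded_swap => //; rewrite /rhoA /rhoF.
  + by move=> m /negbTE ->.
  + by move=> m; rewrite eqxx.
- move=> i _; apply: kbounded_swap => //; rewrite /rhoB.
  + move=> m /eqP mc.
    have -> // : (s - u.+1%:Z < m) && (m <= s) = (s - u%:Z < m) && (m <= s).
    by move: mc; rewrite /c; lia.
  + move=> m; have -> : (s - u.+1%:Z < c) && (c <= s) = true by rewrite /c; lia.
    case: ifP => [mu|//]; apply/negP => /eqP[mc]; move: mu; rewrite mc /c; lia.
Qed.

Let cumulant_limit : A != finset.set0 -> A != [set: 'I_k]%SET ->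
  cumulant P (blend A (fam rhoA) (fam rhooo)) = 0.
Proof.
move=> A0 AT; apply: (cumulant_indep_eq0 A0 AT) => nu.
pose rho i := if i \in A then rhoA else rhooo.
have rI i : injective (rho i) by rewrite /rho; case: ifP.
rewrite !blendE -/rho.
(* The A-block reads originals up to s; the later block reads copies up to s and originals after
   s. *)
pose chi : pred (bool * int) := fun x => x.1 && (x.2 <= s).
pose H (S : {set 'I_k}) (y : bool * int -> E) : R :=
  \prod_(i in S) g (fun j : nat => y (rho i (t i - j%:Z))).
have mH S : prod_measurable (H S).
  apply: (@measurable_prod_in _ (prodType (bool * int) E)) => i _.
  apply: (measurable_comp measurableT _ mg) => //.
  exact: (@measurable_reindex (bool * int) nat _ E (fun j : nat => rho i (t i - j%:Z))).
have iH S : P.-integrable setT (fun w => (H S (fun j => xi j w))%:E).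
  apply: (@moment_integrable _ _ _ P _ S k (fun i => shifted (rho i) (t i)) (fun=> M)).
    by rewrite -[leqRHS]card_ord max_card.
  by move=> i _; exact: kbounded_shifted.
have -> : moment P (fun i => shifted (rho i) (t i)) nu =
   fine (\int[P]_w (H (nu :&: A)%SET (fun j => xi j w) *
                    H (nu :\: A)%SET (fun j => xi j w))%:E)%E.
  congr fine; apply: eq_integral => w _; congr (_%:E).
  by rewrite (finset.big_setID A).
rewrite (iid_expectationM mxi ind (chi := chi) (F := H _) (G := H _)) //.
- by rewrite fineM //; exact: integrable_fin_num.
- move=> y y' yy'; apply: eq_bigr => i; rewrite !inE => /andP[_ iA].
  congr g; apply/funext => j; apply: yy'; rewrite unfold_in /rho !inE iA /chi /=.
  by move: iA; lia.
- move=> y y' yy'; apply: eq_bigr => i; rewrite !inE => /andP[iA _].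
  congr g; apply/funext => j; apply: yy'; rewrite unfold_in /rho !inE (negbTE iA) /= /chi /rhooo.
  by case: ifP => //= ->.
Qed.

Let cumulant_tail : A != finset.set0 -> A != [set: 'I_k]%SET ->
  forall eta : R, 0 < eta -> exists N, forall u, (N <= u)%N ->
  `|cumulant P (blend A (fam rhoA) (fam (rhoB u)))| <= eta.
Proof.
move=> A0 AT eta eta0.
(* The bound of [cumulant_diff_le] is [c * e] when each of the k slots moves by at most e and the
   others are bounded by M. *)
pose c := cumulant_const k * (k%:R * M ^+ k.-1).
have c0 : 0 <= c by rewrite mulr_ge0 ?cumulant_const_ge0 // mulr_ge0 // exprn_ge0.
pose e := eta / (c + 1).
have e0 : 0 < e by rewrite divr_gt0 // ltr_wpDl.
have cv i : exists N, forall u, (N <= u)%N ->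
    kbounded P k (fun w => shifted (rhoB u) (t i) w - shifted rhooo (t i) w) e.
  have := @resample_Lk_cvg _ T R P _ E _ xi mxi ind eqmarg
    (fun u j => rhoB u (t i - j%:Z)) (fun j => rhooo (t i - j%:Z))
    (fun u => shift_inj (t := t i) (@rhoB_inj u)) (shift_inj (t := t i) rhooo_inj).
  have cvs j : exists N, forall u, (N <= u)%N ->
      rhoB u (t i - j%:Z) = rhooo (t i - j%:Z).
    exists (absz (s - (t i - j%:Z))%R).+1 => u uN; rewrite /rhoB /rhooo.
    by case: (leP (t i - j%:Z) s) => [ts|]; rewrite ?andbF // andbT ifT //; lia.
  move=> /(_ cvs k g k0 mg); have [_ _ +] := @kbounded_shifted rhooo (t i) rhooo_inj.
  move=> /le_lt_trans/(_ (ltry _)) fin /(_ fin) /(_ _ (exprn_gt0 k e0))[N HN].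
  exists N => u /HN {}HN; split => //; last exact: ltW.
  by apply: measurable_funB; exact: measurable_shifted.
have [N HN] := choice cv.
exists (\max_i N i)%N => u uN.
rewrite -[X in `|X|]subr0 -(cumulant_limit A0 AT).
apply: le_trans (cumulant_diff_le (n := fun=> M) (e := fun=> e) _ _ _) _.
- exact: kbounded_blend.
- exact: kbounded_blend.
- move=> i; rewrite !blendE; case: ifP => iA; last first.
    by apply: HN; apply: leq_trans uN; exact: leq_bigmax.
  have [mm z zi] := kbounded_zero P k0 (@measurable_shifted rhoA (t i)).
  split => //; first exact: ltW.
  by apply: le_trans zi _; rewrite expr0n gtn_eqF //= lee_fin exprn_ge0 // ltW.
have -> : \sum_(j < k) e * \prod_(i < k | i != j) M = e * (k%:R * M ^+ k.-1).
  rewrite -mulr_sumr; congr (_ * _).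
  rewrite (eq_bigr (fun=> M ^+ k.-1)) ?sumr_const ?card_ord ?mulr_natl // => j _.
  by rewrite prodr_const cardC1 card_ord.
rewrite mulrCA -/c /e mulrAC ler_pdivrMr ?ltr_wpDl // ler_wpM2l ?(ltW eta0) //.
by rewrite lerDl.
Qed.

Lemma cumulant_split_le : A != finset.set0 -> A != [set: 'I_k]%SET ->
  ((`|cumulant P (fun i => shifted (pair true) (t i))|)%:E <=
   (cumulant_const k * M ^+ k.-2)%:E *
   \sum_(a in A) \sum_(b in ~: A)
     \sum_(0 <= v <oo) (n v * n (v + absz (t b - t a)%R)%N)%:E)%E.
Proof.
move=> A0 AT; apply/lee_addgt0Pr => eta eta0.
have [N /(_ N (leqnn _)) HN] := cumulant_tail A0 AT eta0.
have -> : (fun i => shifted (pair true) (t i)) = blend A (fam rhoA) (fam (rhoB 0)).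
  rewrite blendE; apply/funext => i; case: ifP => // _.
  congr (shifted _ _); apply/funext => m; rewrite /rhoB ifF //; lia.
set W := fun u => cumulant P (blend A (fam rhoA) (fam (rhoB u))).
have WN : W 0%N = (\sum_(u < N) (W u - W u.+1)) + W N.
  rewrite -(big_mkord xpredT (fun u => W u - W u.+1)).
  have /= := @telescope_sumr R 0 N (fun u => - W u) (leq0n N).
  under eq_bigr do rewrite opprK addrC.
  by move=> ->; rewrite opprK; ring.
rewrite -/(W 0%N) WN.
apply: (@le_trans _ _ ((\sum_(u < N) `|W u - W u.+1|)%:E + eta%:E)%E).
  rewrite -EFinD lee_fin; apply: le_trans (ler_normD _ _) _.
  by rewrite lerD // ler_norm_sum.
rewrite leeD2r //.
set K := cumulant_const k * M ^+ k.-2.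
have K0 : 0 <= K by rewrite mulr_ge0 ?cumulant_const_ge0 // exprn_ge0.
apply: (@le_trans _ _ (K * \sum_(a in A) \sum_(b in ~: A)
    \sum_(u < N) nz (t a - (s - u%:Z)) * nz (t b - (s - u%:Z)))%:E).
  rewrite lee_fin.
  apply: (@le_trans _ _ (\sum_(u < N) K * \sum_(a in A) \sum_(b in ~: A)
      nz (t a - (s - u%:Z)) * nz (t b - (s - u%:Z)))).
    by apply: ler_sum => u _; exact: cumulant_step.
  rewrite -mulr_sumr ler_wpM2l // exchange_big /= le_eqVlt; apply/orP; left; apply/eqP.
  by apply: eq_bigr => a _; rewrite exchange_big.
rewrite EFinM lee_wpmul2l // -sumEFin; apply: lee_sum => a aA.
rewrite -sumEFin; apply: lee_sum => b bA.
move: aA bA; rewrite !inE => aA bA.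
(* With c = s - u the lag v = t_a - c is u - p, and t_b - c = v + q; for u < p the index c lies
   after t_a and the term is 0. *)
pose p := absz (s - t a)%R; pose q := absz (t b - t a)%R.
pose h v : R := n v * n (v + q)%N.
have h0 v : 0 <= h v by rewrite mulr_ge0.
apply: (@le_trans _ _ (\sum_(0 <= v < N) (h v)%:E)%E); last first.
  by apply: nneseries_lim_ge => v _ _; rewrite lee_fin.
rewrite sumEFin lee_fin -(big_mkord xpredT
  (fun u : nat => nz (t a - (s - u%:Z)) * nz (t b - (s - u%:Z)))).
have low (u : nat) : (u < p)%N -> nz (t a - (s - u%:Z)) * nz (t b - (s - u%:Z)) = 0.
  move=> up; have : t a - (s - u%:Z) < 0 by move: up; rewrite /p; lia.
  by case: (t a - (s - u%:Z)) => //= i _; rewrite mul0r.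
have high (u : nat) : nz (t a - (s - (u + p)%N%:Z)) * nz (t b - (s - (u + p)%N%:Z)) = h u.
  have -> : t a - (s - (u + p)%N%:Z) = u by rewrite /p; lia.
  by have -> : t b - (s - (u + p)%N%:Z) = (u + q)%N by rewrite /p /q; lia.
have [Np|pN] := leqP N p.
  rewrite big_nat big1 ?sumr_ge0 // => u /andP[_ uN].
  by apply: low; exact: leq_trans Np.
rewrite (big_cat_nat (n := p)) //=; last exact: ltnW.
rewrite big_nat big1 ?add0r; last by move=> u /andP[_ up]; exact: low.
rewrite -{1}[p]add0n big_addn; under eq_bigr do rewrite high.
rewrite [leRHS](big_cat_nat (n := (N - p)%N)) //= ?leq_subr //.
by rewrite lerDl sumr_ge0.
Qed.

End Split.
End SplitBound.

(** * Summation over configurations *)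

Section LatticeSums.
Local Open Scope classical_set_scope.
Local Open Scope ring_scope.

(** The d consecutive gaps of the sorted times add up to the span, so d times the largest one is at
    least the span. Any a and b on opposite sides straddle that gap, whence the bound for every such
    pair; s is its left end. *)
Lemma largest_gap (d : nat) (t : 'I_d.+1 -> int) (i0 j0 : 'I_d.+1) : t i0 != t j0 ->
  exists s : int, [/\ exists a, t a <= s, exists b, s < t b &
    forall a b i j, t a <= s -> s < t b -> `|t i - t j| <= d%:Z * (t b - t a)].
Proof.
move=> tij.
pose x := sort <=%O (codom t).
have sx : size x = d.+1 by rewrite size_sort size_codom card_ord.
have srt : sorted <=%O x by exact: sort_le_sorted.
have xt i : exists2 m, (m < d.+1)%N & t i = nth 0 x m.
  have tx : t i \in x by rewrite mem_sort codom_f.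
  by exists (index (t i) x); rewrite ?nth_index // -sx index_mem.
have tx m : (m < d.+1)%N -> exists i, nth 0 x m = t i.
  move=> md; have : nth 0 x m \in x by rewrite mem_nth ?sx.
  by rewrite mem_sort => /codomP.
have le_x m m' : (m <= m')%N -> (m' < d.+1)%N -> nth 0 x m <= nth 0 x m'.
  move=> mm' m'd.
  by apply: (sorted_leq_nth le_trans le_refl) => //; rewrite inE sx //; exact: leq_ltn_trans m'd.
case: d t i0 j0 tij x sx srt xt tx le_x => [|d] t i0 j0 tij x sx srt xt tx le_x.
  by move: tij; rewrite !ord1 eqxx.
pose gap (m : 'I_d.+1) := nth 0 x m.+1 - nth 0 x m.
pose m := [arg max_(m > ord0) gap m]%O.
have gapm i : gap i <= gap m by rewrite /m; case: arg_maxP => // j _ H; exact: (H i isT).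
have span : nth 0 x d.+1 - nth 0 x 0 <= d.+1%:Z * gap m.
  rewrite -(telescope_sumr (nth 0 x)) // big_mkord.
  apply: (@le_trans _ _ (\sum_(i < d.+1) gap m)).
    by apply: ler_sum => i _; exact: gapm.
  by rewrite sumr_const card_ord -mulr_natl natz.
have dist i j : `|t i - t j| <= nth 0 x d.+1 - nth 0 x 0.
  have [p pd ->] := xt i; have [q qd ->] := xt j.
  have := le_x 0%N p (leq0n _) pd; have := le_x 0%N q (leq0n _) qd.
  have := le_x p d.+1 pd (ltnSn _); have := le_x q d.+1 qd (ltnSn _).
  lia.
have gap0 : 0 < gap m.
  rewrite ltNge; apply/negP => g0.
  have := le_trans (dist i0 j0) span.
  have : d.+1%:Z * gap m <= 0 by rewrite mulr_ge0_le0.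
  by move=> h1 h2; have := le_trans h2 h1; rewrite normr_le0 subr_eq0 (negbTE tij).
have md := ltn_ord m.
exists (nth 0 x m); split.
- by have [a xa] := tx m (ltnW md); exists a; rewrite xa.
- by have [b xb] := tx m.+1 md; exists b; rewrite -xb -subr_gt0.
- move=> a b i j ta tb; apply: le_trans (dist i j) _; apply: le_trans span _.
  rewrite ler_wpM2l // /gap lerB //.
  have [p pd tbp] := xt b; rewrite tbp; apply: (le_x m.+1 p) => //.
  rewrite ltnNge; apply/negP => pm; move: tb; rewrite tbp ltNge.
  by rewrite le_x // ltnW.
Qed.

(** The times $(0,k_1,\ldots,k_d)$, in the form used by the theorem. *)
Definition anchor (d : nat) (k : 'I_d -> int) (i : 'I_d.+1) : int :=
  match unlift ord0 i with Some j => k j | None => 0 end.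

Lemma anchor0 d (k : 'I_d -> int) : anchor k ord0 = 0.
Proof. by rewrite /anchor unlift_none. Qed.

Lemma anchor_lift d (k : 'I_d -> int) j : anchor k (lift ord0 j) = k j.
Proof. by rewrite /anchor liftK. Qed.

Definition wide_gap (d : nat) (a b : 'I_d.+1) (q : nat) (k : 'I_d -> int) : Prop :=
  anchor k b - anchor k a = q%:Z /\
  forall i, `|anchor k i - anchor k a| <= d%:Z * q%:Z.

(* [a] and [b] are pinned relative to each other and [ord0] fixes the translation, so
   d-1 coordinates remain free. *)
Lemma size_wide_gap (d : nat) (a b : 'I_d.+1) (q : nat) (X : seq ('I_d -> int)) :
  (0 < q)%N -> uniq X -> (forall k, k \in X -> wide_gap a b q k) ->
  (size X <= (2 * d * q).+1 ^ d.-1)%N.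
Proof.
move=> q0 uX HX.
have [->//|[k0 k0X]] : X = [::] \/ exists k, k \in X.
  by case: (X) => [|k X']; [left|right; exists k; rewrite mem_head].
have ab : a != b.
  by have [kab _] := HX _ k0X; apply/eqP => ab; move: kab; rewrite ab subrr => /eqP; lia.
pose I : finType := {i : 'I_d.+1 | (i != a) && (i != b)}.
(* Offsets from slot a lie between -dq and dq; adding dq leaves 2dq + 1 possible values. *)
pose Phi (k : 'I_d -> int) : {ffun I -> 'I_(2 * d * q).+1} :=
  [ffun i => inord (absz (anchor k (val i) - anchor k a + d%:Z * q%:Z))].
have PhiI : {in X &, injective Phi}.
  move=> k k' /HX[kab kd] /HX[k'ab k'd] /ffunP e.
  have diff i : anchor k i - anchor k a = anchor k' i - anchor k' a.
    have [->|ia] := eqVneq i a; first by rewrite !subrr.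
    have [->|ib] := eqVneq i b; first by rewrite kab k'ab.
    have iab : (i != a) && (i != b) by rewrite ia.
    have := e (Sub i iab); rewrite !ffunE /= => /(congr1 val) /=.
    have := kd i; have := k'd i => h' h.
    rewrite !inordK; lia.
  have eqa : anchor k a = anchor k' a by have := diff ord0; rewrite !anchor0; lia.
  by apply/funext => j; have := diff (lift ord0 j); rewrite !anchor_lift; lia.
have uP : uniq (map Phi X) by rewrite map_inj_in_uniq.
rewrite -(size_map Phi) -(card_uniqP uP); apply: leq_trans (max_card _) _.
rewrite card_ffun card_ord card_sig leq_pexp2l //.
have := cardC (pred2 a b); rewrite card2 ab card_ord => e.
have -> : #|[pred i | (i != a) && (i != b)]| = #|predC (pred2 a b)|.
  by apply: eq_card => i; rewrite !inE negb_or.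
by move: e; set N := #|predC _|; rewrite /=; lia.
Qed.

Context {R : realType}.
Variable n : nat -> R.
Hypothesis n0 : forall i, 0 <= n i.

Local Open Scope ereal_scope.

Let G (q : nat) : \bar R := \sum_(0 <= v <oo) (n v * n (v + q)%N)%:E.

Let G0 q : 0 <= G q.
Proof. by apply: nneseries_ge0 => v _ _; rewrite lee_fin mulr_ge0. Qed.

Lemma esum_wide_gap_fiber (d : nat) (a b : 'I_d.+1) (q : nat) (c : \bar R) :
  (0 < q)%N -> 0 <= c ->
  \esum_(k in [set: 'I_d -> int]) (if `[< wide_gap a b q k >] then c else 0) <=
  ((2 * d * q).+1 ^ d.-1)%:R%:E * c.
Proof.
move=> q0 c0; apply: ge_ereal_sup => _ [X [finX _] <-].
rewrite fsbig_finite //= -big_mkcond /= -big_filter.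
set Y := [seq _ <- _ | _].
have uY : uniq Y by rewrite filter_uniq // finmap.fset_uniq.
have -> : \sum_(i <- Y) c = (size Y)%:R%:E * c.
  elim: (Y) => [|k s IH] /=; first by rewrite big_nil mul0e.
  by rewrite big_cons IH -nat1r EFinD ge0_muleDl ?lee_fin // mul1e.
apply: lee_wpmul2r => //; rewrite lee_fin ler_nat.
apply: (size_wide_gap (a := a) (b := b)) => // k.
by rewrite mem_filter => /andP[/asboolP].
Qed.

Let leq_exp2r_wk (a b p : nat) : (a <= b)%N -> (a ^ p <= b ^ p)%N.
Proof. by case: p => // p ab; rewrite leq_exp2r. Qed.

Lemma esum_exchange (T1 T2 : choiceType) (f : T1 -> T2 -> \bar R) :
  (forall i j, 0 <= f i j) ->
  \esum_(i in [set: T1]) \esum_(j in [set: T2]) f i j =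
  \esum_(j in [set: T2]) \esum_(i in [set: T1]) f i j.
Proof.
move=> f0; rewrite (esum_esum (J := fun=> setT)) // (esum_esum (J := fun=> setT)) //.
rewrite (reindex_esum ([set: T2] `*`` (fun=> setT)) _ (fun x => (x.2, x.1))) //.
split => //=.
- by move=> [i1 i2] [j1 j2] /= _ _ [-> ->].
- by move=> [i1 i2] _ /=; exists (i2, i1).
Qed.

(* With m = v + q the weight q^(d-1) is at most m^(d-1), so the double sum factors. *)
Lemma nneseries_lag_fin (p : nat) :
  \sum_(0 <= m <oo) ((m ^ p)%:R * n m)%:E < +oo ->
  \sum_(0 <= q <oo) (q ^ p)%:R%:E * G q < +oo.
Proof.
move=> S1.
have nd0 m : 0 <= ((m ^ p)%:R * n m)%:E by rewrite lee_fin mulr_ge0.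
have nn0 m : 0 <= (n m)%:E by rewrite lee_fin.
set S := \sum_(0 <= m <oo) _ in S1.
have Sge0 : 0 <= S by exact: nneseries_ge0.
have S0 : \sum_(0 <= m <oo) (n m)%:E < +oo.
  (* The weight can vanish only at m = 0, so that term is split off; elsewhere it is at least 1. *)
  rewrite (@nneseriesD1 _ _ 0%N) //; apply: lte_add_pinfty; first exact: ltry.
  apply: le_lt_trans S1; rewrite /S [leRHS](@nneseriesD1 _ _ 0%N) //.
  apply: (@le_trans _ _ (\sum_(0 <= k <oo | k != 0%N) ((k ^ p)%:R * n k)%:E)); last by rewrite leeDr.
  apply: lee_nneseries => // m /= m0.
  by rewrite lee_fin ler_peMl // ler1n expn_gt0 lt0n m0.
rewrite [ltLHS](_ : _ = \sum_(0 <= q <oo) \sum_(0 <= v <oo)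
    ((q ^ p)%:R%:E * (n v * n (v + q)%N)%:E)); last first.
  by apply: eq_eseriesr => q _; rewrite nneseriesZl // => v _; rewrite lee_fin mulr_ge0.
rewrite nneseries_interchange; last first.
  by move=> q v; rewrite -EFinM lee_fin mulr_ge0 // mulr_ge0.
apply: (@le_lt_trans _ _ (\sum_(0 <= v <oo) ((fine S)%:E * (n v)%:E))).
  apply: lee_nneseries.
    move=> v _ _; apply: nneseries_ge0 => q _ _.
    by rewrite -EFinM lee_fin mulr_ge0 // mulr_ge0.
  move=> v _; rewrite fineK ?ge0_fin_numE // muleC.
  apply: (@le_trans _ _ (\sum_(0 <= q <oo)
      ((n v)%:E * (((q + v) ^ p)%:R * n (q + v)%N)%:E))).
    apply: lee_nneseries.
      by move=> q _ _; rewrite -EFinM lee_fin mulr_ge0 // mulr_ge0.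
    move=> q _; rewrite -!EFinM lee_fin [(v + q)%N]addnC mulrCA.
    by rewrite ler_wpM2l // ler_wpM2r // ler_nat leq_exp2r_wk // leq_addr.
  rewrite nneseriesZl // lee_wpmul2l //.
  rewrite (nneseries_addn (f := fun m => ((m ^ p)%:R * n m)%:E)) //.
  rewrite /S [leRHS](nneseries_split _ v) // add0n leeDr //.
  by rewrite sume_ge0.
rewrite nneseriesZl // -ge0_fin_numE; last first.
  by rewrite mule_ge0 ?lee_fin ?fine_ge0 // nneseries_ge0.
by rewrite fin_numM // ge0_fin_numE // nneseries_ge0.
Qed.

Lemma esum_wide_gap_fin (d : nat) (a b : 'I_d.+1) :
  \sum_(0 <= m <oo) ((m ^ d.-1)%:R * n m)%:E < +oo ->
  \esum_(k in [set: 'I_d -> int])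
    (if `[< anchor k a < anchor k b /\
            forall i, `|anchor k i - anchor k a| <= d%:Z * (anchor k b - anchor k a) >]%R
     then \sum_(0 <= v <oo) (n v * n (v + absz (anchor k b - anchor k a)%R)%N)%:E else 0)
  < +oo.
Proof.
move=> S1.
(* For q >= 1, 2dq + 1 <= (2d + 1) q, so the number of configurations is at most c q^(d-1). *)
pose c : R := ((2 * d).+1 ^ d.-1)%:R.
apply: (@le_lt_trans _ _ (\esum_(k in [set: 'I_d -> int]) \esum_(q in [set: nat])
  (if (0 < q)%N && `[< wide_gap a b q k >] then G q else 0))).
  apply: le_esum => k _; case: ifPn => [/asboolP[ab kd]|_]; last first.
    by apply: esum_ge0 => q _; case: ifP.
  pose q := absz (anchor k b - anchor k a)%R.
  have q0 : (0 < q)%N by rewrite /q; move: ab; lia.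
  have kq : wide_gap a b q k.
    have e : (anchor k b - anchor k a = q%:Z)%R by rewrite /q; move: ab; lia.
    by split => // i; rewrite -e.
  rewrite -/q -/(G q).
  apply: esum_ge; exists [set q]; first by split.
  by rewrite fsbig_set1 q0 (asboolT kq).
rewrite esum_exchange; last by move=> k q; case: ifP.
rewrite -nneseries_esumT; last by move=> q; apply: esum_ge0 => k _; case: ifP.
apply: (@le_lt_trans _ _ (\sum_(0 <= q <oo) (c%:E * ((q ^ d.-1)%:R%:E * G q)))).
  apply: lee_nneseries.
    by move=> q _ _; apply: esum_ge0 => k _; case: ifP.
  move=> q _; case: (posnP q) => [->|q0] /=.
    by rewrite esum1 // mule_ge0 ?mule_ge0 // lee_fin.
  apply: le_trans (esum_wide_gap_fiber a b q0 (G0 q)) _.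
  rewrite muleA lee_wpmul2r // -EFinM lee_fin /c -natrM ler_nat -expnMn.
  by rewrite leq_exp2r_wk // mulSn; move: q0; lia.
have Gq0 q : 0 <= (q ^ d.-1)%:R%:E * G q by rewrite mule_ge0 // lee_fin.
rewrite nneseriesZl // -ge0_fin_numE; last by rewrite mule_ge0 ?nneseries_ge0 // lee_fin.
by rewrite fin_numM // ge0_fin_numE ?nneseries_ge0 //; exact: nneseries_lag_fin.
Qed.

End LatticeSums.

(** * Powers of L^k norms as k-th moments *)

Section LnormMoments.
Local Open Scope ring_scope.
Context {dT} {T : measurableType dT} {R : realType} (P : probability T R).

Lemma Lnorm_exprn (k : nat) (Y : T -> R) : (0 < k)%N ->
  (Lnorm P k%:R%:E (EFin \o Y) < +oo)%E ->
  (\int[P]_w (`|Y w| ^+ k)%:E <= (fine (Lnorm P k%:R%:E (EFin \o Y)) ^+ k)%:E)%E.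
Proof.
move=> k0 fin; have kr : (k%:R : R) != 0 by rewrite pnatr_eq0 -lt0n.
have NE : Lnorm P k%:R%:E (EFin \o Y) \is a fin_num.
  by rewrite ge0_fin_numE // Lnorm_ge0.
have := poweR_Lnorm P (EFin \o Y) kr; rewrite -{1}(fineK NE) poweR_EFin.
rewrite powR_mulrn ?fine_ge0 ?Lnorm_ge0 // => ->.
rewrite le_eqVlt; apply/orP; left; apply/eqP; apply: eq_integral => w _.
by rewrite /= powR_mulrn.
Qed.

Lemma Lnorm_lty (k : nat) (Y : T -> R) : (0 < k)%N ->
  (\int[P]_w (`|Y w| ^+ k)%:E < +oo)%E -> (Lnorm P k%:R%:E (EFin \o Y) < +oo)%E.
Proof.
move=> k0 fin; rewrite unlock; apply: poweR_lty.
by under eq_integral => w _ do rewrite /= powR_mulrn //.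
Qed.

End LnormMoments.

(** * From the gap bound to summability over all configurations *)

Local Open Scope classical_set_scope.
Local Open Scope ring_scope.

Lemma esumZl_le (R : realType) (T : choiceType) (c : R) (a : T -> \bar R) : (0 <= c)%R ->
  (forall i, 0 <= a i)%E ->
  (\esum_(i in [set: T]) (c%:E * a i) <= c%:E * \esum_(i in [set: T]) a i)%E.
Proof.
move=> c0 a0; apply: ge_ereal_sup => _ [X [finX _] <-].
rewrite -ge0_mule_fsumr //; apply: lee_wpmul2l; first by rewrite lee_fin.
by apply: ereal_sup_ubound; exists X.
Qed.

Theorem theorem5 (R : realType) (dT : measure_display) (T : measurableType dT)
  (P : probability T R) (dE : measure_display) (E : measurableType dE)
  (eps eps' : int -> T -> E) (g : (nat -> E) -> R) (d : nat) :
  (2 <= d)%N ->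
  (* innovations measurable *)
  (forall i, measurable_fun setT (eps i)) ->
  (forall i, measurable_fun setT (eps' i)) ->
  (* (eps_i) and its copy (eps'_i) are jointly i.i.d. *)
  mutually_independent P (fun b : bool * int =>
    if b.1 then eps b.2 else eps' b.2) ->
  (forall i A, measurable A ->
     P (eps i @^-1` A) = P (eps 0 @^-1` A) /\
     P (eps' i @^-1` A) = P (eps 0 @^-1` A)) ->
  (* g measurable *)
  prod_measurable_fun g ->
  (* X_i in L^{d+1} and centered *)
  (forall i : int, ('N[P]_(d.+1%:R%:E)[EFin \o bshift g eps i] < +oo)%E) ->
  (forall i : int, ('E_P[bshift g eps i] = 0)%E) ->
  (* sum_k k^{d-1} delta_{d+1}(k) < oo *)
  (\sum_(0 <= k <oo) ((k ^ d.-1)%:R%:E * fdm P g eps eps' d.+1%:R k) < +oo)%E ->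
  (\esum_(k in [set: 'I_d -> int])
     (`| cumulant P (fun i : 'I_d.+1 =>
           bshift g eps (match unlift ord0 i with
                         | Some j => k j | None => 0 end)) |)%:E < +oo)%E.
Proof.
move=> _ meps meps' ind marg mg XL _ Sfin.
pose xi (b : bool * int) := if b.1 then eps b.2 else eps' b.2.
have mxi b : measurable_fun setT (xi b) by rewrite /xi; case: ifP.
have eqmarg i j A : measurable A -> P (xi i @^-1` A) = P (xi j @^-1` A).
  move=> mA; have H b : P (xi b @^-1` A) = P (eps 0 @^-1` A).
    by rewrite /xi; case: b.1; have [] := marg b.2 _ mA.
  by rewrite !H.
have mg' : prod_measurable g.
  by move=> _ B mB; rewrite setTI; exact: mg.
pose k := d.+1; have k0 : (0 < k)%N by [].
pose M := fine (Lnorm P k%:R%:E (EFin \o bshift g eps 0)).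
have M0 : 0 <= M by rewrite fine_ge0 // Lnorm_ge0.
have intM : (\int[P]_w (`|shifted xi g (pair true) 0 w| ^+ k)%:E <= (M ^+ k)%:E)%E.
  by apply: Lnorm_exprn => //; exact: XL.
have starE i : bshift_star g eps eps' i = shifted xi g single_swap i.
  apply/funext => w; congr g; apply/funext => j; rewrite /pull /single_swap /xi.
  by case: ifP.
have swapI : injective single_swap.
  by move=> a b; rewrite /single_swap; case: eqP => [->|?]; case: eqP => // ? [].
(* Finiteness makes [fine] lossless below: the coupled variable has the law of $X_i$, and Minkowski
   bounds the difference. *)
have fdm_fin i : (fdm P g eps eps' k%:R i < +oo)%E.
  rewrite /fdm starE.
  have [mS _ iS] := kbounded_shifted mxi ind eqmarg mg' k0 M0 intM i%:Z swapI.
  have mX : measurable_fun setT (bshift g eps i%:Z).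
    exact: (measurable_shifted mxi mg' (pair true)).
  pose NS (w : T) : R := - shifted xi g single_swap i%:Z w.
  have mNS : measurable_fun setT NS by exact: measurableT_comp.
  have NSL : (Lnorm P k%:R%:E (EFin \o NS) < +oo)%E.
    apply: Lnorm_lty => //; apply: le_lt_trans (ltry (M ^+ k)); apply: le_trans iS.
    by rewrite le_eqVlt; apply/orP; left; apply/eqP/eq_integral => w _; rewrite /NS normrN.
  have k1 : (1 <= k%:R :> R) by rewrite ler1n.
  exact: le_lt_trans (minkowski_EFin P mX mNS k1) (lte_add_pinfty (XL _) NSL).
pose n i := fine (fdm P g eps eps' k%:R i).
have n0 i : 0 <= n i by rewrite fine_ge0 // Lnorm_ge0.
have intn (i : nat) : (\int[P]_w (`|shifted xi g (pair true) i%:Z w -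
    shifted xi g single_swap i%:Z w| ^+ k)%:E <= (n i ^+ k)%:E)%E.
  rewrite /n; have := fdm_fin i; rewrite /fdm starE.
  exact: (@Lnorm_exprn _ _ _ P k (fun w => bshift g eps i%:Z w - shifted xi g single_swap i%:Z w)).
have S1 : (\sum_(0 <= m <oo) ((m ^ d.-1)%:R * n m)%:E < +oo)%E.
  rewrite [ltLHS](_ : _ = \sum_(0 <= m <oo) ((m ^ d.-1)%:R%:E * fdm P g eps eps' k%:R m))%E //.
  apply: eq_eseriesr => m _; rewrite EFinM fineK // ge0_fin_numE //; exact: Lnorm_ge0.
pose f (u : 'I_d -> int) : \bar R :=
  (`|cumulant P (fun i : 'I_d.+1 => shifted xi g (pair true) (anchor u i))|)%:E.
rewrite (_ : (\esum_(u in _) _)%E = (\esum_(u in [set: 'I_d -> int]) f u)%E) //.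
pose K : R := cumulant_const k * M ^+ k.-2.
have K0 : 0 <= K by rewrite mulr_ge0 ?cumulant_const_ge0 // exprn_ge0.
(* The cut s depends on u, but every pair that it separates meets this condition; summing over all
   ordered pairs frees the majorant from s. *)
pose h (a b : 'I_d.+1) (u : 'I_d -> int) : \bar R :=
  if `[< anchor u a < anchor u b /\
         forall i, `|anchor u i - anchor u a| <= d%:Z * (anchor u b - anchor u a) >]
  then (\sum_(0 <= v <oo) (n v * n (v + absz (anchor u b - anchor u a)%R)%N)%:E)%E else 0%E.
have h0 a b u : (0 <= h a b u)%E.
  by rewrite /h; case: ifP => // _; apply: nneseries_ge0 => v _ _; rewrite lee_fin mulr_ge0.
(* The configuration with all times equal has no gap to split at; it contributes one finite term. *)
pose z : 'I_d -> int := fun=> 0.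
pose f0 (u : 'I_d -> int) : \bar R := if u \in [set z] then f z else 0%E.
have f00 u : (0 <= f0 u)%E by rewrite /f0; case: ifP => // _; rewrite lee_fin.
have fle u : (f u <= f0 u + K%:E * \sum_a \sum_b h a b u)%E.
  have [[[i0 j0] /= tij]|const] := pselect (exists p : 'I_d.+1 * 'I_d.+1, anchor u p.1 != anchor u p.2).
    have [s [[a1 a1s] [b1 b1s] gap]] := largest_gap tij.
    apply: (@le_trans _ _ (K%:E * \sum_a \sum_b h a b u)%E); last first.
      by rewrite leeDr.
    pose A : {set 'I_d.+1} := [set i | anchor u i <= s]%SET.
    have A0 : A != finset.set0 by apply/set0Pn; exists a1; rewrite inE.
    have AT : A != [set: 'I_d.+1]%SET.
      by apply/eqP => /setP/(_ b1); rewrite !inE leNgt b1s.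
    apply: le_trans (cumulant_split_le mxi ind eqmarg mg' k0 M0 intM n0 intn A0 AT) _.
    rewrite lee_wpmul2l ?lee_fin // big_mkcond /=; apply: lee_sum => a _.
    case: ifPn => aA; last by rewrite sume_ge0.
    rewrite big_mkcond /=; apply: lee_sum => b _; case: ifPn => bA //.
    move: aA bA; rewrite !inE -ltNge => aA bA.
    rewrite /h asboolT //; split; first exact: le_lt_trans bA.
    by move=> i; exact: gap.
  have -> : u = z.
    apply/funext => j; apply/eqP; apply: contrapT => /negP uj; apply: const.
    by exists (lift ord0 j, ord0); rewrite /= anchor_lift anchor0.
  rewrite /f0 mem_set // leeDl // mule_ge0 ?lee_fin // sume_ge0 // => a _.
  by rewrite sume_ge0.
apply: le_lt_trans (le_esum (fun u _ => fle u)) _.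
have hh0 u : (0 <= \sum_a \sum_b h a b u)%E.
  by rewrite sume_ge0 // => a _; rewrite sume_ge0.
rewrite esumD //; last by move=> u _; rewrite mule_ge0 ?lee_fin.
apply: lte_add_pinfty.
  by rewrite /f0 -esum_mkcond esum_set1 ?lee_fin // ltry.
apply: le_lt_trans (esumZl_le K0 hh0) _.
rewrite esum_sum; last by move=> u a _ _; rewrite sume_ge0.
apply: lte_mul_pinfty => //; apply: lte_sum_pinfty => a _.
rewrite esum_sum //; apply: lte_sum_pinfty => b _.
exact: esum_wide_gap_fin.
Qed.
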